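(* Let $P\subset\mathbb{R}^m$ be a convex polytope with non-empty interior $P^o$ and let $\mathcal{B}:P\to\mathcal{M}(P)$ be a Bernstein measure on $P$ with defining matrix $K:P^o\to\mathrm{Sym}(m,\mathbb{R})$. Then for each integer $\nu\ge 0$ there exists a differential operator $L_\nu(x,\partial)$ on $P$ of order $2\nu$ (depending only on $\mathcal{B}$ and $\nu$, not on $f$ or $N$) such that, for every $f\in C^\infty(P)$, the Bernstein approximations $B_N(f)$ have the asymptotic expansion $$B_N(f)\sim\sum_{\nu\ge 0}N^{-\nu}L_\nu(x,\partial)f\qquad (N\to\infty),$$ uniformly on $P$; that is, for every $n\ge 1$, $\sup_{x\in P}\left|B_N(f)(x)-\sum_{\nu=0}^{n-1}N^{-\nu}L_\nu(x,\partial)f(x)\right|=O(N^{-n})$. Moreover $$L_0(x,\partial)f=f(x),\qquad L_1(x,\partial)f=\tfrac12\mathrm{Tr}\big(A(x)\nabla^2f(x)\big),$$ where $\nabla^2 f$ is the Hessian of $f$ and $A(x)\in\mathrm{Sym}(m,\mathbb{R})$ is the inverse of the defining matrix $K(x)$ (for $x \in P^o$; see the context for $x\in\partial P$). The asymptotic expansion can be differentiated any number of times and the resulting expansion holds locally uniformly on $P^o$; that is, for every multi-index $\beta$, every $n\ge1$ and every compact $C\subset P^o$, $\sup_{x\in C}\left|\partial^\beta B_N(f)(x)-\sum_{\nu=0}^{n-1}N^{-\nu}\partial^\beta\big(L_\nu(x,\partial)f\big)(x)\right|=O(N^{-n})$.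
   Context: $C(P)$ is the space of continuous (complex-valued) functions on $P$; $C^\infty(P)$ is the space of functions on $P$ that are smooth up to the boundary (restrictions of smooth functions on $\mathbb{R}^m$). $\mathcal{M}(P)$ is the set of Borel probability measures on $P$ with the weak-$*$ topology, and $b:\mathcal{M}(P)\to P$, $b(\mu)=\int z\,d\mu(z)$, is the barycenter map. Bernstein measure: a continuous map $\mathcal{B}:P\to\mathcal{M}(P)$, written $\mathcal{B}(x)=d\mathcal{B}_x$, with $b(\mathcal{B}(x))=x$ for all $x\in P$ such that (1) for every $f\in C(P)$ the function $B(f)(x)=\int_P f(z)\,d\mathcal{B}_x(z)$ belongs to $C^\infty(P^o)\cap C(P)$; (2) there is a smooth map $K:P^o\to\mathrm{Sym}(m,\mathbb{R})$ (real symmetric $m\times m$ matrices), called the defining matrix, with $\nabla B(f)(x)=\int_P f(z)K(x)(z-x)\,d\mathcal{B}_x(z)$ for all $f\in C(P)$, $x\in P^o$. Bernstein approximation: for $f\in C(P)$ and a positive integer $N$, $B_N(f)(x)=\int_P f\,d\mathcal{B}_x^N$, where $d\mathcal{B}_x^N=(D_{1/N})_*(d\mathcal{B}_x*\cdots*d\mathcal{B}_x)$ ($N$-fold convolution, $D_{1/N}(y)=y/N$); equivalently $B_N(f)(x)=\int_{P^N}f((z^{(1)}+\cdots+z^{(N)})/N)\,d\mathcal{B}_x(z^{(1)})\cdots d\mathcal{B}_x(z^{(N)})$. The matrix $A(x)=\int_P (z-x)\otimes(z-x)\,d\mathcal{B}_x(z)$, where $(v\otimes v)u=\langle v,u\rangle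 v$, is defined and continuous on all of $P$, and it is the inverse of $K(x)$ for $x\in P^o$; at boundary points $A(x)$ means this integral. A differential operator of order $k$ on $P$ means $\sum_{|\alpha|\le k}a_\alpha(x)\partial^\alpha$ with coefficients $a_\alpha$ continuous on $P$ and smooth on $P^o$. *)

(* Defs.v *)
From HB Require Import structures.
From mathcomp Require Import all_boot all_order all_algebra.
From mathcomp Require Import all_classical all_reals all_analysis.
From mathcomp Require Import measurable_realfun complex.

Set Implicit Arguments.
Unset Strict Implicit.
Unset Printing Implicit Defensive.

Import Order.TTheory GRing.Theory Num.Theory.
Import numFieldNormedType.Exports.

Local Open Scope classical_set_scope.
Local Open Scope ring_scope.

Definition polytope (R : realType) (m : nat) (P : set 'rV[R]_m) : Prop :=
  exists (k : nat) (v : 'I_k -> 'rV[R]_m),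
    P = [set x | exists w : 'I_k -> R,
           [/\ forall j, 0 <= w j, \sum_j w j = 1 & x = \sum_j w j *: v j]].

(* The library puts no measurable structure on row vectors: [Borel R m] is R^m
   with the sigma-algebra generated by its open sets. *)
Notation Borel R m := (g_sigma_algebraType (@open 'rV[R]_m)).

Section measurable_operations.
Variables (R : realType) (m : nat).
Implicit Types (U : set 'rV[R]_m).

Definition box (qn : 'rV[rat]_m * nat) : set 'rV[R]_m :=
  [set v | forall i, `|v 0 i - ratr (qn.1 0 i)| < qn.2.+1%:R^-1].

Lemma open_bigcup_box U : open U ->
  U = \bigcup_(qn in [set qn | box qn `<=` U]) box qn.
Proof.
move=> oU; apply/seteqP; split=> [x Ux|x [qn /= sub] /sub//].
have /nbhs_ballP[e /= e0 xeU] : nbhs x U by exact: open_nbhs_nbhs.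
have [n ne] : exists n : nat, n.+1%:R^-1 < e / 2.
  have /ltr_add_invr[n] : 0 < e / 2 by exact: divr_gt0.
  by rewrite add0r => ?; exists n.
have n0 : 0 < n.+1%:R^-1 :> R by rewrite invr_gt0.
have /choice[q qP] : forall i, exists q : rat,
    `|x 0 i - ratr q| < n.+1%:R^-1.
  move=> i.
  have [q] := @rat_in_itvoo R (x 0 i - n.+1%:R^-1) (x 0 i + n.+1%:R^-1)
    ltac:(by rewrite ltrBlDr -addrA ltrDl addr_gt0).
  by rewrite in_itv /= => ?; exists q; rewrite distrC ltr_distl.
exists (\row_i q i, n); last by move=> i /=; rewrite mxE.
move=> v /= vq; apply: xeU; split=> // i j; rewrite (ord1 i) /ball /=.
have := vq j; rewrite /= mxE => {}vq.
rewrite (le_lt_trans (ler_distD (ratr (q j)) _ _))// [ltRHS]splitr.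
by rewrite ltrD ?(lt_trans _ ne)// distrC.
Qed.

Lemma measurable_coord (i : 'I_m) :
  measurable_fun setT (fun v : Borel R m => v 0 i).
Proof.
apply: (measurability _ (RGenOpens.measurableE R)).
move=> _ [_ [a [b ->]] <-]; rewrite setTI; apply: sub_sigma_algebra.
apply: (@open_comp _ _ (fun v : 'rV[R]_m => v 0 i)); last exact: interval_open.
by move=> v _; exact: coord_continuous.
Qed.

Lemma measurable_fun_Borel d (T : measurableType d) (f : T -> Borel R m) :
  (forall i, measurable_fun setT (fun t => f t 0 i)) -> measurable_fun setT f.
Proof.
move=> mf; apply: (@measurability _ _ T (Borel R m) _ f (@open _)) => //.
move=> _ [U oU <-]; rewrite setTI (open_bigcup_box oU) preimage_bigcup.
rewrite bigcup_mkcond; apply: countable_bigcupT_measurable => [|qn].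
  exact: countableP.
case: ifPn => _; last exact: measurable0.
have -> : f @^-1` box qn =
    \bigcap_(i in [set: 'I_m]) ((fun t => f t 0 i) @^-1`
      ball (ratr (qn.1 0 i) : R) qn.2.+1%:R^-1).
  apply/seteqP; split=> t /= h i; first by move=> _; rewrite /ball /= distrC.
  by rewrite distrC; exact: h.
apply: fin_bigcap_measurable => [|i _]; first exact: finite_finset.
rewrite -[X in measurable X]setTI; apply: mf => //.
by apply: open_measurable; exact: ball_open.
Qed.

Definition borel_add (p : Borel R m * Borel R m) : Borel R m :=
  (p.1 : 'rV[R]_m) + p.2.

Lemma measurable_borel_add : measurable_fun setT borel_add.
Proof.
apply: measurable_fun_Borel => i.
rewrite (_ : (fun p => _) =
    fun p : Borel R m * Borel R m => p.1 0 i + p.2 0 i); last first.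
  by apply/funext => p; rewrite /borel_add mxE.
apply: measurable_funD.
  exact: (measurableT_comp (measurable_coord i) measurable_fst).
exact: (measurableT_comp (measurable_coord i) measurable_snd).
Qed.

HB.instance Definition _ := isMeasurableFun.Build _ _ _ _ borel_add measurable_borel_add.

Definition borel_scale (c : R) (v : Borel R m) : Borel R m := c *: (v : 'rV[R]_m).

Lemma measurable_borel_scale c : measurable_fun setT (borel_scale c).
Proof.
apply: measurable_fun_Borel => i.
rewrite (_ : (fun v => _) = fun v : Borel R m => c * v 0 i); last first.
  by apply/funext => v; rewrite /borel_scale mxE.
by apply: measurable_funM => //; exact: measurable_coord.
Qed.

HB.instance Definition _ c :=
  isMeasurableFun.Build _ _ _ _ (borel_scale c) (measurable_borel_scale c).

Definition convolution (mu nu : probability (Borel R m) R) :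
    probability (Borel R m) R :=
  distribution (mu \x nu)%E borel_add.

Fixpoint convolution_power (mu : probability (Borel R m) R) (N : nat) :
    probability (Borel R m) R :=
  match N with
  | 0 => @dirac _ (Borel R m) (0 : 'rV[R]_m) R
  | 1 => mu
  | N'.+1 => convolution mu (convolution_power mu N')
  end.

(* [(D_{1/N})_* (mu * ... * mu)], with [N] factors. *)
Definition bernstein_power (mu : probability (Borel R m) R) (N : nat) :
    probability (Borel R m) R :=
  distribution (convolution_power mu N) (borel_scale N%:R^-1).

End measurable_operations.

Section smooth_functions.
Variables (R : realType) (m : nat).
Local Notation V := 'rV[R]_m.
Implicit Types (U P : set V) (g : V -> R) (f : V -> R[i]) (i : 'I_m).

Definition partial i g : V -> R := fun x => 'D_(delta_mx 0 i) g x.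

Definition partials (s : seq 'I_m) g : V -> R := foldr partial g s.

(* [U] is meant to be open: derivatives are taken in R^m. *)
Definition smooth_on U g : Prop :=
  forall (s : seq 'I_m) x, U x ->
    {for x, continuous (partials s g)} /\
    (forall i, derivable (partials s g) x (delta_mx 0 i)).

(* Complex-valued functions are treated through their real and imaginary
   parts, that is, with C identified with R^2. *)
Definition by_parts (T : (V -> R) -> R) f : R[i] :=
  Complex (T (@complex.Re R \o f)) (T (@complex.Im R \o f)).

Definition ccontinuous_on P f : Prop :=
  {within P, continuous (@complex.Re R \o f)} /\
  {within P, continuous (@complex.Im R \o f)}.

Definition csmooth_on U f : Prop :=
  smooth_on U (@complex.Re R \o f) /\ smooth_on U (@complex.Im R \o f).

Definition cintegral (mu : probability (Borel R m) R) P f : R[i] :=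
  by_parts (fun g => \int[mu]_(z in P) g z) f.

Definition cpartial i f : V -> R[i] := fun x => by_parts (partial i ^~ x) f.

Definition cderiv (al : 'I_m -> nat) f : V -> R[i] :=
  foldr (fun i => iter (al i) (cpartial i)) f (enum 'I_m).

Definition hessian f (x : V) : 'M[R[i]]_m :=
  \matrix_(i, j) cpartial i (cpartial j f) x.

Definition multi_index (k : nat) : predArgType :=
  {al : {ffun 'I_m -> 'I_k.+1} | (\sum_i al i <= k)%N}.

Record diff_operator P (k : nat) := DiffOperator {
  coef : multi_index k -> V -> R[i];
  coef_continuous : forall al, ccontinuous_on P (coef al);
  coef_smooth : forall al, csmooth_on P° (coef al)
}.

(* A function smooth up to the boundary of [P] is represented by a smooth
   extension [f] to R^m. When [P] is a polytope with non-empty interior, it is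
   the closure of its interior, so the derivatives of [f] at the points of [P]
   do not depend on the extension. *)
Definition diff_apply P k (L : diff_operator P k) f : V -> R[i] :=
  fun x =>
    \sum_(al : multi_index k) coef L al x * cderiv (fun i => val al i) f x.

(* [sup_S |e N| = O(N^-n)] as [N] tends to infinity. *)
Definition uniform_bigO (S : set V) (n : nat) (e : nat -> V -> R[i]) : Prop :=
  exists c : R, \forall N \near \oo,
    forall x, S x -> Normc.normc (e N x) <= c * N%:R ^- n.

End smooth_functions.

Section bernstein.
Variables (R : realType) (m : nat).
Local Notation V := 'rV[R]_m.
Variables (P : set V) (B : V -> probability (Borel R m) R).

Definition bernstein_fun (f : V -> R[i]) : V -> R[i] :=
  fun x => cintegral (B x) P f.

(* A Borel probability measure on [P] is represented by one on R^m that gives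
   mass 1 to [P]; the values of [B] outside [P] play no role. *)
Record bernstein_measure (K : V -> 'M[R]_m) : Prop := BernsteinMeasure {
  bernstein_supp : forall x, P x -> B x P = 1%E;
  bernstein_weak_continuous : forall f,
    ccontinuous_on P f -> ccontinuous_on P (bernstein_fun f);
  bernstein_barycenter : forall x, P x ->
    x = \row_i \int[B x]_(z in P) (z : V) 0 i;
  bernstein_smooth : forall f, ccontinuous_on P f ->
    csmooth_on P° (bernstein_fun f) /\ ccontinuous_on P (bernstein_fun f);
  defining_sym : forall x, P° x -> (K x)^T = K x;
  defining_smooth : forall i j, smooth_on P° (fun x => K x i j);
  bernstein_gradient : forall f, ccontinuous_on P f -> forall x, P° x ->
    forall i, cpartial i (bernstein_fun f) x =
      cintegral (B x) P
        (fun z => f z * (real_complex R ((K x *m (z - x)^T) i 0)))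
}.

Definition bernstein_approx (N : nat) (f : V -> R[i]) : V -> R[i] :=
  fun x => cintegral (bernstein_power (B x) N) P f.

Definition covariance_matrix (x : V) : 'M[R]_m :=
  \matrix_(i, j) \int[B x]_(z in P) ((z - x : V) 0 i * (z - x : V) 0 j).

End bernstein.

(* Main.v *)
(** Write [E_N] for the expectation of [f(S_N / N)], where [S_N] is a sum of [N]
independent copies of [B x].  The centred moments of [S_N] satisfy
[F_{N+1}(s) - F_N(s) = sum m(a) F_N(b)] over the splittings of the word [s] into
[a] and [b] with [|a| >= 2], because [m] vanishes on words of length 1; hence
[F_N(s)] is a polynomial in [N] of degree at most [|s|/2].  Taylor's formula of
order [2n] at [x] then gives the uniform expansion, with coefficients that are
polynomials in the central moments of [B x].

For the derivatives, the gradient identity of [B x] passes to its convolution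
powers: [d_i E_N(f) = N sum_j K_ij (E_N(z_j f) - x_j E_N(f))].  Comparing the
expansions of both sides (uniform limits of derivatives) shows that the operators
satisfy [d_i L_nu f = sum_j K_ij (L_{nu+1}(z_j f) - x_j L_{nu+1} f)], so that the
remainder of order [n] for [f] is differentiated into [N] times remainders of order
[n+1] for [f] and the [z_j f].  Induction on the number of derivatives finishes the
proof without returning to the measures. *)
Require Import Defs.
From mathcomp Require Import all_boot all_order all_algebra.
From mathcomp Require Import all_classical all_reals all_analysis.
From mathcomp Require Import measurable_realfun complex.
From mathcomp Require Import ring lra zify.

Set Implicit Arguments.
Unset Strict Implicit.
Unset Printing Implicit Defensive.

Import Order.TTheory GRing.Theory Num.Theory.
Import numFieldNormedType.Exports.

Local Open Scope classical_set_scope.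
Local Open Scope ring_scope.

(** * Directional derivatives and Taylor's formula *)

(** Smoothness means continuity of all iterated partial derivatives along the coordinate axes. No
    total differential comes with it, and every analytic step is reduced to the mean value theorem
    on a line.

    The hypotheses on [B] concern a single copy and integrands free of x. Under a convolution power
    x enters through each of the N copies, and the intermediate integrands depend on x as well. This
    is why joint continuity, uniform over compact supports, and differentiation along a diagonal are
    needed.

    [K] is given only inside P, and nothing bounds it near the boundary. The uniform expansion is
    therefore built from moments alone, which are continuous on all of P; [K] is used only on
    compact subsets of the interior.

    Taylor's formula is taken to order 2n for n terms because a centred moment of order 2n grows
    like [N ^ n]: divided by [N ^ (2n)] it leaves [N ^- n]. The factor N lost with each derivative
    is affordable since the expansion holds to every order and for every smooth function.

    Words in the coordinates replace multi-indices until the very end, which avoids multinomial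
    coefficients. *)

Section directional.
Variables (R : realType) (V : normedModType R).
Implicit Types (g : V -> R) (x v : V).

(** Clearing the denominator removes the punctured neighbourhood: the bound also makes sense at
    [t = 0], and statements about lines and translates become rewritings. *)
Lemma is_deriveP_eps g x v l : is_derive x v g l <->
  forall e, 0 < e -> exists2 d : R, 0 < d & forall t : R, `|t| < d ->
    `|g (x + t *: v) - g x - t * l| <= e * `|t|.
Proof.
split=> [[dg gl] e e0|h].
  have /cvgrPdist_le/(_ _ e0) : (fun h => h^-1 *: (g (h *: v + x) - g x)) @ 0^' --> l.
    by rewrite -gl; exact: dg.
  rewrite near_withinE => /nbhs_ballP[d /= d0 H].
  exists d => // t td.
  have [->|t0] := eqVneq t 0.
    by rewrite scale0r addr0 mul0r subrr subr0 normr0 mulr0.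
  have := H t; rewrite /ball /= sub0r normrN => /(_ td t0).
  rewrite -(@ler_pM2l _ `|t|) ?normr_gt0// -normrM mulrBr.
  rewrite {2}/GRing.scale/= mulrA divff// mul1r addrC distrC.
  by rewrite addrC (addrC x) [e * _]mulrC.
have H : (fun h => h^-1 *: (g (h *: v + x) - g x)) @ 0^' --> l.
  apply/cvgrPdist_le => e e0; have [d d0 H] := h _ e0.
  rewrite near_withinE; apply/nbhs_ballP; exists d => //= t.
  rewrite /ball /= sub0r normrN => td t0.
  rewrite -(@ler_pM2l _ `|t|) ?normr_gt0// -normrM mulrBr.
  rewrite {2}/GRing.scale/= mulrA divff// mul1r distrC.
  by rewrite (addrC _ x) [_ * e]mulrC H.
by split; [apply/cvg_ex; exists l|exact: cvg_lim H].
Qed.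

End directional.

Section line.
Variables (R : realType) (V : normedModType R).
Implicit Types (g : V -> R) (x v w : V).

(** Moving along [v] from [x + t *: v] is moving the parameter from [t], so both epsilon conditions
    are the same inequality. One-variable calculus enters through this equivalence. *)
Lemma is_derive_line g x v l (t : R) :
  is_derive (x + t *: v) v g l <-> is_derive t 1 (fun s : R => g (x + s *: v)) l.
Proof.
have E (s : R) : x + t *: v + s *: v = x + (t + s *: (1 : R)) *: v.
  by rewrite -addrA -scalerDl /GRing.scale /= mulr1.
split=> /is_deriveP_eps h.
  apply/is_deriveP_eps => e /h[d d0 H].
  by exists d => // s sd; have := H s sd; rewrite E.
apply/is_deriveP_eps => e /h[d d0 H].
by exists d => // s sd; have := H s sd; rewrite E.
Qed.

Lemma is_derive_translate g x v w l :
  is_derive (x + w) v g l -> is_derive x v (fun y => g (y + w)) l.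
Proof.
move=> /is_deriveP_eps h; apply/is_deriveP_eps => e /h[d d0 H].
by exists d => // t td; rewrite (addrAC x); exact: H.
Qed.

Lemma is_derive_dscale g x v l (c : R) :
  is_derive x v g l -> is_derive x (c *: v) g (c * l).
Proof.
move=> /is_deriveP_eps h; apply/is_deriveP_eps => e e0.
have c1 : 0 < `|c| + 1 by rewrite ltr_wpDl.
have [d d0 H] := h (e / (`|c| + 1)) (divr_gt0 e0 c1).
exists (d / (`|c| + 1)) => [|t td]; first exact: divr_gt0.
rewrite scalerA mulrA; apply: le_trans (H _ _) _.
  rewrite normrM (le_lt_trans _ (_ : `|t| * (`|c| + 1) < d)) -?ltr_pdivlMr//.
  by rewrite ler_wpM2l// lerDl.
rewrite normrM -mulrA ler_pM2l// -ler_pdivlMl ?invr_gt0// invrK mulrC.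
by rewrite ler_wpM2r// lerDl.
Qed.

(** The sign of [t] is free: [|s| <= |t|] replaces membership in the segment between 0 and [t], and
    each sign takes one application of the one-variable theorem. *)
Lemma MVT_dir g x v (dg : V -> R) (t : R) :
  (forall s : R, `|s| <= `|t| -> is_derive (x + s *: v) v g (dg (x + s *: v))) ->
  exists2 s : R, `|s| <= `|t| & g (x + t *: v) - g x = t * dg (x + s *: v).
Proof.
move=> h.
have d1 (s : R) : `|s| <= `|t| ->
    is_derive s 1 (fun s : R => g (x + s *: v)) (dg (x + s *: v)).
  by move=> /h /is_derive_line.
have ct (a b : R) : (forall s : R, s \in `[a, b] -> `|s| <= `|t|) ->
    {within `[a, b], continuous (fun s : R => g (x + s *: v))}.
  move=> ab; apply: derivable_within_continuous => s sab.
  by have [] := d1 s (ab _ sab).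
have [t0|t0] := leP 0 t.
  have H (s : R) : s \in `[0, t] -> `|s| <= `|t|.
    by rewrite in_itv/= => /andP[s0 st]; rewrite !ger0_norm.
  have [||c c0t] := MVT_segment t0 (f := fun s => g (x + s *: v))
    (df := fun s => dg (x + s *: v)).
  - by move=> s s0t; apply/d1/H/(subitvP _ s0t); rewrite subitvE /= !bound_lexx.
  - exact: ct.
  - rewrite scale0r addr0 subr0 mulrC => ->; exists c => //; exact: H.
have H (s : R) : s \in `[t, 0] -> `|s| <= `|t|.
  rewrite in_itv/= => /andP[s0 st]; rewrite (ler0_norm st) (ltr0_norm t0).
  by rewrite lerN2.
have [||c c0t] := MVT_segment (ltW t0) (f := fun s => g (x + s *: v))
  (df := fun s => dg (x + s *: v)).
- by move=> s s0t; apply/d1/H/(subitvP _ s0t); rewrite subitvE /= !bound_lexx.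
- exact: ct.
- rewrite scale0r addr0 sub0r => E; exists c; first exact: H.
  by rewrite -opprB E mulrN opprK mulrC.
Qed.

End line.

Section diagonal.
Variable R : realType.

(* Only separate derivatives of [H] are required: the mean value theorem in the first
   variable replaces joint differentiability. *)
Lemma is_derive_diag (H g : R -> R -> R) (l d : R) : 0 < d ->
  (forall a b : R, `|a| < d -> `|b| < d -> is_derive a 1 (H ^~ b) (g a b)) ->
  (forall e, 0 < e -> exists2 c : R, 0 < c & forall a b : R, `|a| < c -> `|b| < c ->
    `|g a b - g 0 0| <= e) ->
  is_derive (0 : R) 1 (H 0) l -> is_derive (0 : R) 1 (fun t : R => H t t) (g 0 0 + l).
Proof.
move=> d0 dH gc /is_deriveP_eps dl; apply/is_deriveP_eps => e e0.
have e2 : 0 < e / 2 by rewrite divr_gt0.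
have [c c0 gc'] := gc _ e2; have [c' c'0 dl'] := dl _ e2.
exists (Num.min d (Num.min c c')) => [|t]; first by rewrite !lt_min d0 c0.
rewrite !lt_min => /and3P[td tc tc'].
rewrite add0r scaler1.
have := dl' t tc'; rewrite add0r scaler1 => Hl.
have [s st] : exists2 s : R, `|s| <= `|t| & H (0 + t *: 1) t - H 0 t = t * g (0 + s *: 1) t.
  apply: (MVT_dir (g := H ^~ t) (x := 0 : R) (v := 1 : R) (dg := g ^~ t)) => s st.
  by apply: dH => //; rewrite add0r scaler1 (le_lt_trans st).
rewrite !add0r !scaler1 => E.
have -> : H t t - H 0 0 - t * (g 0 0 + l) =
    t * (g s t - g 0 0) + (H 0 t - H 0 0 - t * l).
  by rewrite mulrBr -E; ring.
rewrite (le_trans (ler_normD _ _))// [leRHS](_ : _ = `|t| * (e / 2) + e / 2 * `|t|).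
  by rewrite lerD// normrM ler_wpM2l// gc'// (le_lt_trans st).
by lra.
Qed.

End diagonal.

(** * Algebra of smooth functions on an open set *)

Section smooth.
Variables (R : realType) (m : nat).
Local Notation V := 'rV[R]_m.
Implicit Types (U : set V) (g h : V -> R) (i : 'I_m) (s : seq 'I_m).

(** [smooth_on] speaks of all words at once and offers nothing to induct on; the truncation at order
    [k] does. *)
Definition smooth_upto (k : nat) U g : Prop :=
  forall s, (size s <= k)%N -> forall x, U x ->
    {for x, continuous (partials s g)} /\
    (forall i, derivable (partials s g) x (delta_mx 0 i)).

Lemma smooth_onP U g : smooth_on U g <-> forall k, smooth_upto k U g.
Proof.
by split=> [h k s _ x Ux|h s x Ux]; [exact: h|exact: (h (size s))].
Qed.

Lemma partials_rcons s i g : partials (rcons s i) g = partials s (partial i g).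
Proof. by rewrite /partials foldr_rcons. Qed.

Lemma smooth_on_partials U g s : smooth_on U g -> smooth_on U (partials s g).
Proof.
by move=> sg t x Ux; have := sg (t ++ s) x Ux; rewrite /partials foldr_cat.
Qed.

Lemma smooth_on_partial U g i : smooth_on U g -> smooth_on U (partial i g).
Proof. exact: (@smooth_on_partials U g [:: i]). Qed.

Lemma smooth_on_subset U U' g : U' `<=` U -> smooth_on U g -> smooth_on U' g.
Proof. by move=> sub sg s x /sub; exact: sg. Qed.

Lemma smooth_on_continuous U g x : smooth_on U g -> U x -> {for x, continuous g}.
Proof. by move=> sg Ux; have [] := sg [::] x Ux. Qed.

Lemma smooth_on_derivable U g i x : smooth_on U g -> U x ->
  derivable g x (delta_mx 0 i).
Proof. by move=> sg Ux; have [_] := sg [::] x Ux; apply. Qed.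

Lemma is_derive_partial U g i x : smooth_on U g -> U x ->
  is_derive x (delta_mx 0 i) g (partial i g x).
Proof. by move=> sg Ux; apply/derivableP; exact: smooth_on_derivable Ux. Qed.

Lemma near_eq_on U g h x : open U -> (forall y, U y -> g y = h y) -> U x ->
  {near x, g =1 h}.
Proof. by move=> oU gh Ux; apply: filterS (open_nbhs_nbhs (conj oU Ux)) => y /gh. Qed.

Lemma eq_partials U g h : open U -> (forall y, U y -> g y = h y) ->
  forall s x, U x -> partials s g x = partials s h x.
Proof.
move=> oU gh; elim=> [|i s IH] x Ux; first exact: gh.
by apply: near_eq_derive; exact: (near_eq_on oU IH Ux).
Qed.

Lemma eq_smooth_upto U g h k : open U -> (forall y, U y -> g y = h y) ->
  smooth_upto k U g -> smooth_upto k U h.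
Proof.
move=> oU gh sg s sk x Ux; have [cg dg] := sg s sk x Ux.
have E := eq_partials oU gh s.
have N := near_eq_on oU E Ux; split=> [|i].
  rewrite /prop_for /continuous_at -E//; apply: cvg_trans cg.
  by apply: (@near_eq_cvg _ _ (nbhs x)); apply: filterS N => y ->.
by apply: near_eq_derivable (dg i); exact: N.
Qed.

Lemma smooth_upto_le U g j k : (j <= k)%N -> smooth_upto k U g -> smooth_upto j U g.
Proof. by move=> jk sg s sj; apply: sg; exact: leq_trans jk. Qed.

(** The letter removed is the last one, that is, the innermost derivative: it acts on [g] itself,
    for which the sum and product rules hold as identities on [U]. *)
Lemma smooth_uptoS U g k : smooth_upto k.+1 U g <->
  smooth_upto 0 U g /\ forall i, smooth_upto k U (partial i g).
Proof.
split=> [sg|[g0 gS] s]; last first.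
  case/lastP: s => [_|s i]; first exact: g0.
  by rewrite size_rcons ltnS partials_rcons; exact: gS.
split=> [|i s sk]; first exact: smooth_upto_le sg.
by rewrite -partials_rcons; apply: sg; rewrite size_rcons.
Qed.

Lemma smooth_upto0 U g : (forall x, U x -> {for x, continuous g} /\
  forall i, derivable g x (delta_mx 0 i)) -> smooth_upto 0 U g.
Proof. by move=> h [|//] _ x /h. Qed.

Lemma smooth_on_cst U (c : R) : smooth_on U (fun=> c).
Proof.
apply/smooth_onP => k; elim: k c => [|k IH] c.
  apply: smooth_upto0 => x _; split=> [|i]; first exact: cst_continuous.
  exact: derivable_cst.
apply/smooth_uptoS; split=> [|i]; first exact: smooth_upto_le (IH c).
rewrite (_ : partial i _ = fun=> 0)//; apply/funext => x.
exact: derive_cst.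
Qed.

Lemma smooth_uptoD U g h k : open U ->
  smooth_upto k U g -> smooth_upto k U h -> smooth_upto k U (fun x => g x + h x).
Proof.
move=> oU; elim: k g h => [|k IH] g h sg sh.
  apply: smooth_upto0 => x Ux.
  have [[cg dg] [ch dh]] := (sg [::] isT x Ux, sh [::] isT x Ux).
  by split=> [|i]; [exact: continuousD|exact: derivableD].
move/smooth_uptoS: (sg) (sh) => [sg0 sgS] /smooth_uptoS[sh0 shS].
apply/smooth_uptoS; split=> [|i].
  by apply: smooth_upto_le (IH _ _ (smooth_upto_le _ sg) (smooth_upto_le _ sh)).
apply: eq_smooth_upto (IH _ _ (sgS i) (shS i)) => // x Ux.
have [[_ dg] [_ dh]] := (sg0 [::] isT x Ux, sh0 [::] isT x Ux).
by apply/esym/deriveD.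
Qed.

(** By Leibniz's rule a derivative of the product is a sum of two products of functions smooth to
    order [k], hence the appeal to [smooth_uptoD]. *)
Lemma smooth_uptoM U g h k : open U ->
  smooth_upto k U g -> smooth_upto k U h -> smooth_upto k U (fun x => g x * h x).
Proof.
move=> oU; elim: k g h => [|k IH] g h sg sh.
  apply: smooth_upto0 => x Ux.
  have [[cg dg] [ch dh]] := (sg [::] isT x Ux, sh [::] isT x Ux).
  by split=> [|i]; [exact: continuousM|exact: derivableM].
have [sg1 sh1] := (smooth_upto_le (leqnSn _) sg, smooth_upto_le (leqnSn _) sh).
move/smooth_uptoS: (sg) (sh) => [sg0 sgS] /smooth_uptoS[sh0 shS].
apply/smooth_uptoS; split=> [|i]; first exact: smooth_upto_le (IH _ _ sg1 sh1).
apply: eq_smooth_upto (smooth_uptoD oU (IH _ _ sg1 (shS i))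
                                       (IH _ _ sh1 (sgS i))) => // x Ux.
have [[_ dg] [_ dh]] := (sg0 [::] isT x Ux, sh0 [::] isT x Ux).
exact/esym/deriveM.
Qed.

Lemma smooth_onD U g h : open U ->
  smooth_on U g -> smooth_on U h -> smooth_on U (fun x => g x + h x).
Proof.
by move=> oU /smooth_onP sg /smooth_onP sh; apply/smooth_onP => k; exact: smooth_uptoD.
Qed.

Lemma smooth_onM U g h : open U ->
  smooth_on U g -> smooth_on U h -> smooth_on U (fun x => g x * h x).
Proof.
by move=> oU /smooth_onP sg /smooth_onP sh; apply/smooth_onP => k; exact: smooth_uptoM.
Qed.

Lemma smooth_onZ U (c : R) g : open U -> smooth_on U g -> smooth_on U (fun x => c * g x).
Proof. by move=> oU; apply: smooth_onM => //; exact: smooth_on_cst. Qed.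

Lemma smooth_onN U g : open U -> smooth_on U g -> smooth_on U (fun x => - g x).
Proof.
move=> oU /(smooth_onZ (-1) oU); congr (smooth_on U).
by apply/funext => x; rewrite mulN1r.
Qed.

Lemma smooth_onB U g h : open U ->
  smooth_on U g -> smooth_on U h -> smooth_on U (fun x => g x - h x).
Proof. by move=> oU sg /(smooth_onN oU); exact: smooth_onD. Qed.

Lemma smooth_on_sum U (I : Type) (r : seq I) (Q : pred I) (G : I -> V -> R) :
  open U -> (forall a, Q a -> smooth_on U (G a)) ->
  smooth_on U (fun x => \sum_(a <- r | Q a) G a x).
Proof.
move=> oU sG; elim: r => [|a r IH].
  by under eq_fun do rewrite big_nil; exact: smooth_on_cst.
under eq_fun do rewrite big_cons.
by case: (boolP (Q a)) => [Qa|_]; [exact: smooth_onD oU (sG a Qa) IH|exact: IH].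
Qed.

Lemma smooth_upto_sum U (I : Type) (r : seq I) (G : I -> V -> R) k :
  open U -> (forall a, smooth_upto k U (G a)) ->
  smooth_upto k U (fun x => \sum_(a <- r) G a x).
Proof.
move=> oU sG; elim: r => [|a r IH].
  under eq_fun do rewrite big_nil.
  by have /smooth_onP := @smooth_on_cst U 0; exact.
by under eq_fun do rewrite big_cons; exact: smooth_uptoD.
Qed.

Lemma eq_smooth_on U g h : open U -> (forall y, U y -> g y = h y) ->
  smooth_on U g -> smooth_on U h.
Proof.
by move=> oU gh /smooth_onP sg; apply/smooth_onP => k; exact: eq_smooth_upto (sg k).
Qed.

Lemma is_derive_coord i (x v : V) : is_derive x v (fun y : V => y 0 i) (v 0 i).
Proof.
apply/is_deriveP_eps => e e0; exists 1 => // t _.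
set a := (_ - _); have -> : a = 0 by rewrite /a /= !mxE; ring.
by rewrite normr0 mulr_ge0// ltW.
Qed.

Lemma smooth_on_coord U i : smooth_on U (fun x => x 0 i).
Proof.
apply/smooth_onP; case=> [|k].
  apply: smooth_upto0 => x _; split=> [|j]; first exact: coord_continuous.
  by have [] := is_derive_coord i x (delta_mx 0 j).
apply/smooth_uptoS; split=> [|j].
  apply: smooth_upto0 => x _; split=> [|j]; first exact: coord_continuous.
  by have [] := is_derive_coord i x (delta_mx 0 j).
rewrite (_ : partial j _ = fun=> (delta_mx 0 j : V) 0 i).
  by have /smooth_onP := @smooth_on_cst U ((delta_mx 0 j : V) 0 i); exact.
by apply/funext => x; have [] := is_derive_coord i x (delta_mx 0 j).
Qed.

Lemma partialsD U g h s x : open U -> smooth_on U g -> smooth_on U h -> U x ->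
  partials s (fun x => g x + h x) x = partials s g x + partials s h x.
Proof.
move=> oU sg sh; elim: s x => // i s IH x Ux.
transitivity ('D_(delta_mx 0 i) (partials s g + partials s h) x).
  by apply: near_eq_derive; exact: (near_eq_on oU IH Ux).
by apply: deriveD; [have [_] := sg s x Ux|have [_] := sh s x Ux]; exact.
Qed.

Lemma partialsZ U (c : R) g s x : open U -> smooth_on U g -> U x ->
  partials s (fun x => c * g x) x = c * partials s g x.
Proof.
move=> oU sg; elim: s x => // i s IH x Ux.
transitivity ('D_(delta_mx 0 i) (c \*: partials s g) x).
  by apply: near_eq_derive; exact: (near_eq_on oU IH Ux).
by apply: deriveZ; have [_] := sg s x Ux; exact.
Qed.

Lemma partialsB U g h s x : open U -> smooth_on U g -> smooth_on U h -> U x ->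
  partials s (fun x => g x - h x) x = partials s g x - partials s h x.
Proof.
move=> oU sg sh Ux; rewrite -mulN1r -(partialsZ (-1) s oU sh Ux).
rewrite -(partialsD s oU sg _ Ux); last exact: smooth_onZ.
by apply: (eq_partials oU) => // y _; rewrite mulN1r.
Qed.

Lemma partials_sum U (I : Type) (r : seq I) (G : I -> V -> R) s x :
  open U -> (forall a, smooth_on U (G a)) -> U x ->
  partials s (fun x => \sum_(a <- r) G a x) x = \sum_(a <- r) partials s (G a) x.
Proof.
move=> oU sG Ux; elim: r => [|a r IH].
  rewrite big_nil -[RHS](mul0r (partials s (fun=> 0) x)).
  rewrite -(partialsZ 0 s oU (@smooth_on_cst U 0) Ux).
  by apply: (eq_partials oU) => // y _; rewrite big_nil mul0r.
rewrite big_cons -IH -(partialsD s oU (sG a) _ Ux); last exact: smooth_on_sum.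
by apply: (eq_partials oU) => // y _; rewrite big_cons.
Qed.

Lemma partialM U g h i x : smooth_on U g -> smooth_on U h -> U x ->
  partial i (fun x => g x * h x) x = g x * partial i h x + h x * partial i g x.
Proof. by move=> sg sh Ux; apply: deriveM; exact: smooth_on_derivable Ux. Qed.

End smooth.

(** * Chain rule, symmetry of mixed derivatives and Taylor's formula *)

Section taylor.
Variables (R : realType) (m : nat).
Local Notation V := 'rV[R]_m.
Implicit Types (g f : V -> R) (i j : 'I_m) (s : seq 'I_m) (x y v : V).

Lemma continuous_eps (W : normedModType R) (g : W -> R) (x : W) :
  {for x, continuous g} <->
  forall e : R, 0 < e -> exists2 d : R, 0 < d & forall y : W, `|y - x| < d ->
    `|g y - g x| <= e.
Proof.
split=> [cg e e0|h].
  have /cvgrPdist_le/(_ _ e0)/nbhs_ballP[d /= d0 H] := cg.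
  exists d => // y yd; rewrite distrC; apply: H.
  by rewrite -ball_normE /= distrC.
apply/cvgrPdist_le => e /h[d d0 H]; apply/nbhs_ballP; exists d => // y.
by rewrite -ball_normE /= distrC => /H; rewrite distrC.
Qed.

Lemma continuous_plane g x u v : {for x, continuous g} ->
  forall e : R, 0 < e -> exists2 d : R, 0 < d & forall a b : R, `|a| < d -> `|b| < d ->
    `|g (x + a *: u + b *: v) - g x| <= e.
Proof.
move=> cg e e0; have [d d0 H] := (continuous_eps _ _).1 cg e e0.
have n0 : 0 < `|u| + `|v| + 1 by rewrite ltr_wpDl// addr_ge0.
exists (d / (`|u| + `|v| + 1)) => [|a b]; first exact: divr_gt0.
rewrite !ltr_pdivlMr// => ad bd; apply: H.
rewrite addrC addrA addrA addNr add0r (le_lt_trans (ler_normD _ _))// !normrZ.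
have [ab|/ltW ab] := leP `|a| `|b|.
  apply: le_lt_trans bd; rewrite !mulrDr mulr1.
  by rewrite -[leLHS]addr0 lerD// lerD// ler_wpM2r.
apply: le_lt_trans ad; rewrite !mulrDr mulr1.
by rewrite -[leLHS]addr0 lerD// lerD// ler_wpM2r.
Qed.

(** A chain rule from partial derivatives alone. The direction is built up one coordinate at a time;
    the increments along the new axis and along the rest are the two variables of
    [is_derive_diag]. *)
Lemma is_derive_total g x v : smooth_on setT g ->
  is_derive x v g (\sum_i v 0 i * partial i g x).
Proof.
move=> sg; rewrite {1}[v]row_sum_delta.
elim: (index_enum _) x => [|i r IH] x; first by rewrite !big_nil; exact: is_derive0.
rewrite !big_cons; set w := \sum_(j <- r) _.
pose H (a b : R) := g (x + a *: (v 0 i *: delta_mx 0 i) + b *: w).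
have [l E] : exists l, l = \sum_(j <- r) v 0 j * partial j g x by eexists.
rewrite -[X in is_derive X](addr0 x) -(scale0r (v 0 i *: delta_mx 0 i + w)).
apply/is_derive_line.
rewrite (_ : (fun t : R => g _) = (fun t : R => H t t)); last first.
  by apply/funext => t; rewrite /H scalerDr addrA.
pose dg a b := v 0 i * partial i g (x + a *: (v 0 i *: delta_mx 0 i) + b *: w).
have -> : v 0 i * partial i g x = dg 0 0 by rewrite /dg !scale0r !addr0.
apply: (@is_derive_diag R H dg _ 1) => //.
- move=> a b _ _; rewrite /H.
  rewrite (_ : (fun a0 : R => _) =
    fun a0 : R => g ((x + b *: w) + a0 *: (v 0 i *: delta_mx 0 i))); last first.
    by apply/funext => c; rewrite addrAC.
  rewrite (_ : dg a b = v 0 i *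
    partial i g ((x + b *: w) + a *: (v 0 i *: delta_mx 0 i))); last first.
    by rewrite /dg addrAC.
  apply: (is_derive_line g _ _ _ _).1; apply: is_derive_dscale.
  exact: is_derive_partial sg I.
- have cg : {for x, continuous (fun y => v 0 i * partial i g y)}.
    exact: smooth_on_continuous (smooth_onZ _ openT (smooth_on_partial i sg)) I.
  move=> e e0; have [d d0 Hd] := continuous_plane (v 0 i *: delta_mx 0 i) w cg e0.
  by exists d => // a b ad bd; rewrite /dg !scale0r !addr0; exact: Hd.
- have := IH x; rewrite -/w -[X in is_derive X _ _ _ -> _](addr0 x) -(scale0r w).
  move=> /is_derive_line; congr (is_derive _ _ _ _).
  by apply/funext => t; rewrite /H scale0r addr0.
Qed.

(** The mean value theorem, applied to the difference in direction [j] and then to [partial i g],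
    turns the second difference into a mixed derivative at a nearby point. *)
Lemma double_difference g x i j (t : R) : smooth_on setT g ->
  exists a b : R, [/\ `|a| <= `|t|, `|b| <= `|t| &
    g (x + t *: delta_mx 0 i + t *: delta_mx 0 j) - g (x + t *: delta_mx 0 i) -
    (g (x + t *: delta_mx 0 j) - g x) =
    t * (t * partial j (partial i g) (x + a *: delta_mx 0 i + b *: delta_mx 0 j))].
Proof.
move=> sg; set u := delta_mx 0 i; set w := delta_mx 0 j.
have [a at_ E] : exists2 a : R, `|a| <= `|t| &
  (fun y => g (y + t *: w) - g y) (x + t *: u) - (fun y => g (y + t *: w) - g y) x
  = t * (partial i g (x + a *: u + t *: w) - partial i g (x + a *: u)).
  apply: (MVT_dir (g := fun y => g (y + t *: w) - g y)
    (dg := fun y => partial i g (y + t *: w) - partial i g y)) => s _.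
  apply: is_deriveB; last exact: is_derive_partial sg I.
  by apply: is_derive_translate; exact: is_derive_partial sg I.
have [b bt E'] : exists2 b : R, `|b| <= `|t| &
  partial i g (x + a *: u + t *: w) - partial i g (x + a *: u) =
  t * partial j (partial i g) (x + a *: u + b *: w).
  apply: (MVT_dir (dg := partial j (partial i g))) => s _.
  exact: is_derive_partial (smooth_on_partial i sg) I.
by exists a, b; split=> //; rewrite -E'.
Qed.

Let ler_dist_half (e p q r z : R) :
  r = z -> `|r - p| <= e / 2 -> `|z - q| <= e / 2 -> `|q - p| <= e.
Proof.
move=> <- h1 h2; rewrite -(subrKA r) (splitr e) (le_trans (ler_normD _ _))// lerD//.
by rewrite distrC.
Qed.

(** Schwarz's theorem: the second difference is symmetric in [i] and [j], so the two mixed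
    derivatives agree at two points as close to [x] as desired, and continuity concludes. *)
Lemma partialC g x i j : smooth_on setT g ->
  partial i (partial j g) x = partial j (partial i g) x.
Proof.
move=> sg; apply/eqP; rewrite -subr_eq0 -normr_le0; apply/ler_addgt0Pl => e e0.
rewrite addr0.
have e2 : 0 < e / 2 by rewrite divr_gt0.
have c a b : {for x, continuous (partial a (partial b g))}.
  exact: smooth_on_continuous (smooth_on_partial a (smooth_on_partial b sg)) I.
have [d d0 H] := continuous_plane (delta_mx 0 i) (delta_mx 0 j) (c j i) e2.
have [d' d'0 H'] := continuous_plane (delta_mx 0 j) (delta_mx 0 i) (c i j) e2.
pose t := Num.min d d' / 2.
have t0 : 0 < t by rewrite divr_gt0// lt_min d0.
have [td td'] : t < d /\ t < d'.
  apply/andP; rewrite -lt_min /t ltr_pdivrMr// mulr_natr mulr2n ltrDl.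
  by rewrite lt_min d0.
have [a [b [at_ bt E]]] := double_difference x i j t sg.
have [a' [b' [at_' bt' E']]] := double_difference x j i t sg.
rewrite (gtr0_norm t0) in at_ bt at_' bt'.
have Ej : partial j (partial i g) (x + a *: delta_mx 0 i + b *: delta_mx 0 j) =
    partial i (partial j g) (x + a' *: delta_mx 0 j + b' *: delta_mx 0 i).
  apply: (@mulfI _ t); first by rewrite gt_eqF.
  apply: (@mulfI _ t); first by rewrite gt_eqF.
  have subACA (p q r z : R) : p - q - (r - z) = p - r - (q - z) by ring.
  apply: etrans (esym E) _; apply: etrans _ E'.
  by rewrite (addrAC x (t *: delta_mx 0 j)); exact: subACA.
exact: ler_dist_half Ej (H _ _ (le_lt_trans at_ td) (le_lt_trans bt td))
  (H' _ _ (le_lt_trans at_' td') (le_lt_trans bt' td')).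
Qed.

(** Exchanges of blocks generate all permutations; they reduce to moving one derivative past a
    block, hence to [partialC]. *)
Lemma partials_perm g s s' x : smooth_on setT g -> perm_eq s s' ->
  partials s g x = partials s' g x.
Proof.
move=> sg /(catCA_perm_ind (P := fun t => partials s g x = partials t g x)).
apply=> // t1 t2 t3 ->; rewrite /partials !foldr_cat.
suff H : forall i (t : seq 'I_m) (h : V -> R), smooth_on setT h ->
    partial i (partials t h) = partials t (partial i h).
  have H2 : forall (t t' : seq 'I_m) (h : V -> R), smooth_on setT h ->
      partials t (partials t' h) = partials t' (partials t h).
    elim=> [|a t IH] t' k sk; first by [].
    exact: etrans (congr1 (partial a) (IH t' k sk)) (H a t' _ (smooth_on_partials t sk)).
  by have := H2 t1 t2 _ (smooth_on_partials t3 sg); rewrite /partials => ->.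
move=> i; elim=> [|j t IH] k sk; first by [].
apply: etrans (congr1 (partial j) (IH k sk)).
apply/funext => y; exact: partialC (smooth_on_partials t sk).
Qed.

(** A mixed derivative occurs once for each ordering of its letters, so [1 / k!] is the only weight
    left in Taylor's formula. *)
Fixpoint words (k : nat) : seq (seq 'I_m) :=
  if k is k'.+1 then [seq i :: s | i <- enum 'I_m, s <- words k'] else [:: [::]].

Lemma mem_words k s : (s \in words k) = (size s == k).
Proof.
elim: k s => [|k IH] [|i s] //=.
  by apply/negP => /allpairsP[[j t] /= []].
rewrite eqSS -IH; apply/allpairsP/idP => [[[j t] /= [_ h [_ ->]]]//|h].
by exists (i, s); rewrite mem_enum.
Qed.

Lemma big_words k (G : seq 'I_m -> R) :
  \sum_(s <- words k.+1) G s = \sum_i \sum_(s <- words k) G (i :: s).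
Proof. by rewrite /= big_allpairs_dep /= big_enum. Qed.

Definition monomial s y : R := \prod_(i <- s) y 0 i.

(** The k-th differential of [g] at [x], evaluated at [y] in all its arguments. *)
Definition taylor_form k g x y : R :=
  \sum_(s <- words k) monomial s y * partials s g x.

Lemma is_derive_taylor_form k g x y : smooth_on setT g ->
  is_derive x y (taylor_form k g ^~ y) (taylor_form k.+1 g x y).
Proof.
move=> sg; rewrite /taylor_form big_words exchange_big /=.
elim: (words k) => [|s r IH].
  under [X in is_derive _ _ X]eq_fun do rewrite big_nil.
  by rewrite big_nil; exact: is_derive_cst.
under [X in is_derive _ _ X]eq_fun do rewrite big_cons.
rewrite big_cons; apply: is_deriveD.
rewrite [X in is_derive _ _ _ X](_ : _ =
    monomial s y * \sum_i y 0 i * partial i (partials s g) x).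
  by apply: is_deriveZ; apply: is_derive_total; exact: smooth_on_partials.
rewrite mulr_sumr; apply: eq_bigr => i _.
by rewrite /monomial big_cons; ring.
Qed.

(* The derivative at [t] of [sum_{j <= n} (1 - t)^j / j! * D^j g(x + t y)] telescopes to
   its last term, so that the mean value theorem on [[0, 1]] suffices. *)
Lemma taylor_expansion g x y n (C : R) : smooth_on setT g ->
  (forall (t : R) s, 0 <= t <= 1 -> size s = n.+1 ->
     `|partials s g (x + t *: y)| <= C) ->
  `|g (x + y) - \sum_(k < n.+1) (k`!%:R)^-1 * taylor_form k g x y| <=
  C * \sum_(s <- words n.+1) `|monomial s y|.
Proof.
move=> sg bC.
pose G (k : nat) (t : R) : R :=
  \sum_(j < k.+1) (1 - t) ^+ j / j`!%:R * taylor_form j g (x + t *: y) y.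
have dG (k : nat) (t : R) : is_derive t (1 : R) (G k)
    ((1 - t) ^+ k / k`!%:R * taylor_form k.+1 g (x + t *: y) y).
  have dT (j : nat) : is_derive t (1 : R) (fun t : R => taylor_form j g (x + t *: y) y)
      (taylor_form j.+1 g (x + t *: y) y).
    by apply/(is_derive_line (taylor_form j g ^~ y)); exact: is_derive_taylor_form.
  elim: k => [|k IH].
    rewrite (_ : G 0%N = fun t => taylor_form 0 g (x + t *: y) y); last first.
      by apply/funext => u; rewrite /G big_ord1 expr0 fact0 divr1 mul1r.
    rewrite expr0 fact0 divr1 mul1r; exact: dT.
  rewrite (_ : G k.+1 = fun t => G k t +
    (1 - t) ^+ k.+1 / k.+1`!%:R * taylor_form k.+1 g (x + t *: y) y); last first.
    by apply/funext => u; rewrite /G big_ord_recr.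
  have dp : is_derive t (1 : R) (fun t : R => (1 - t) ^+ k.+1 / k.+1`!%:R)
      (- ((1 - t) ^+ k / k`!%:R)).
    have d1 : is_derive t (1 : R) (fun t : R => 1 - t) (-1).
      rewrite -[X in is_derive _ _ _ X]add0r; apply: is_deriveB.
    have dn : is_derive t (1 : R) (fun t : R => (1 - t) ^+ k.+1) (- (k.+1%:R * (1 - t) ^+ k)).
      have := is_deriveX k.+1 d1; rewrite exprfctE /GRing.scale /= mulrN1.
      exact.
    rewrite (_ : (fun t : R => _) = (k.+1`!%:R^-1 \*: (fun t : R => (1 - t) ^+ k.+1))); last first.
      by apply/funext => u /=; rewrite mulrC.
    apply: is_derive_eq (is_deriveZ _ dn) _; rewrite /GRing.scale /= factS natrM invfM.
    have k0 : k.+1%:R != 0 :> R by rewrite pnatr_eq0.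
    by rewrite mulrN mulrACA mulVf// mul1r mulrC.
  apply: is_derive_eq (is_deriveD IH (is_deriveM dp (dT k.+1))) _.
  by rewrite /GRing.scale /=; ring.
have G1 : G n 1 = g (x + y).
  rewrite /G big_ord_recl expr0 fact0 divr1 mul1r scale1r big1 ?addr0.
    by rewrite /taylor_form /= big_seq1 /monomial big_nil mul1r.
  by move=> i _; rewrite subrr expr0n /= !mul0r.
have G0 : G n 0 = \sum_(k < n.+1) (k`!%:R)^-1 * taylor_form k g x y.
  apply: eq_bigr => i _; rewrite subr0 expr1n mul1r scale0r addr0//.
have cG : {within `[0, 1], continuous (G n)}.
  by apply: derivable_within_continuous => t _; have [] := dG n t.
have [c c01 E] := MVT_segment ler01 (fun t _ => dG n t) cG.
rewrite -G1 -G0 E subr0 mulr1.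
move: c01; rewrite in_itv/= => /andP[c0 c1].
(* The factor [(1 - c) ^+ n / n!] is at most 1, which leaves [C] alone as the constant. *)
rewrite normrM -[leRHS]mul1r; apply: ler_pM => //.
  rewrite normrM normfV normr_nat normrX -[leRHS](mulr1 1) ler_pM//.
    by rewrite exprn_ile1// ger0_norm ?subr_ge0// lerBlDr lerDl.
  by rewrite invf_le1 ?ltr0n ?fact_gt0// ler1n fact_gt0.
rewrite (le_trans (ler_norm_sum _ _ _))// mulr_sumr !big_seq.
apply: ler_sum => s; rewrite mem_words => /eqP ss.
by rewrite normrM mulrC ler_wpM2r// bC// c0.
Qed.

End taylor.

(** * Moments of sums of independent vectors *)

Section splits.
Variable T : eqType.
Implicit Types (s a b : seq T).

(** All distributions of the letters of a word over two subwords, order kept and with multiplicity: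
    the index set for expanding a product of sums. *)
Fixpoint splits s : seq (seq T * seq T) :=
  if s is x :: s' then
    [seq (x :: p.1, p.2) | p <- splits s'] ++ [seq (p.1, x :: p.2) | p <- splits s']
  else [:: ([::], [::])].

Lemma size_splits s p : p \in splits s -> (size p.1 + size p.2)%N = size s.
Proof.
elim: s p => [|x s IH] p /=; first by rewrite inE => /eqP ->.
by rewrite mem_cat => /orP[] /mapP[q /IH <- ->] /=; rewrite ?addnS.
Qed.

(** The single distribution with empty first part is the one whose term reproduces the moment of the
    preceding sum. *)
Lemma splits_nil1 s : [seq p <- splits s | nilp p.1] = [:: ([::], s)].
Proof.
elim: s => //= x s IH; rewrite filter_cat !filter_map /=.
rewrite (eq_filter (a2 := pred0)) // filter_pred0 /=.
by rewrite (eq_filter (a2 := fun p => nilp p.1))// IH.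
Qed.

Lemma prod_splits (R : comNzRingType) (u v : T -> R) s :
  \prod_(i <- s) (u i + v i) =
  \sum_(p <- splits s) (\prod_(i <- p.1) u i) * (\prod_(i <- p.2) v i).
Proof.
elim: s => [|x s IH]; first by rewrite big_nil /= big_seq1 !big_nil mul1r.
rewrite big_cons IH /= big_cat /= !big_map mulrDl !mulr_sumr.
by congr (_ + _); apply: eq_bigr => p _; rewrite big_cons /=; ring.
Qed.

End splits.

Section moments.
Variables (R : realType) (T : eqType) (mom : seq T -> R).
Implicit Types (s : seq T).

(* [sum_coef k s] is the coefficient of ['C(N, k)] in the moment of order [s]
   of a sum of [N] independent centered copies with moments [mom]. *)
Fixpoint sum_coef (k : nat) s : R :=
  if k is k'.+1 then
    \sum_(p <- splits s | (1 < size p.1)%N) mom p.1 * sum_coef k' p.2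
  else (nilp s)%:R.

(** The binomial basis, rather than powers of [N], suits a recursion that is a difference equation
    in [N]. *)
Definition sum_moment (N : nat) s : R :=
  \sum_(k < (size s).+1) sum_coef k s * 'C(N, k)%:R.

(** Each of the [k] rounds takes at least two letters from [s]. Hence the degree in [N] is at most
    half the length of [s]. *)
Lemma sum_coef_eq0 k s : (size s < k.*2)%N -> sum_coef k s = 0.
Proof.
elim: k s => // k IH s sk /=; rewrite big_seq_cond big1// => p /andP[ps p1].
rewrite IH ?mulr0//; have := size_splits ps; move: sk p1; rewrite doubleS.
by move: (size p.1) (size p.2) (size s) => a b c; lia.
Qed.

Lemma sum_momentE K N s : (size s < K)%N ->
  sum_moment N s = \sum_(k < K) sum_coef k s * 'C(N, k)%:R.
Proof.
move=> sK; rewrite /sum_moment (big_ord_widen K (fun k => sum_coef k s * 'C(N, k)%:R))//.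
rewrite [RHS](bigID (fun k : 'I_K => (k < (size s).+1)%N)) /= [X in _ = _ + X]big1 ?addr0//.
move=> k; rewrite -leqNgt => sk.
by rewrite sum_coef_eq0 ?mul0r// -addnn; lia.
Qed.

Lemma sum_moment0 s : sum_moment 0 s = (nilp s)%:R.
Proof.
rewrite /sum_moment big_ord_recl bin0 mulr1 big1 ?addr0// => k _.
by rewrite bin0n mulr0.
Qed.

Hypotheses (mom0 : mom [::] = 1) (mom1 : forall i, mom [:: i] = 0).

(** Pascal's rule splits ['C(N.+1, k.+1)]. One half rebuilds the moment for [N], the term with empty
    first part; the other is, by definition of [sum_coef], the sum over first parts of length at
    least two. First parts of length one vanish by [mom1]. *)
Lemma sum_momentS N s :
  sum_moment N.+1 s = \sum_(p <- splits s) mom p.1 * sum_moment N p.2.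
Proof.
rewrite (bigID (fun p => nilp p.1)) /= -big_filter splits_nil1 big_seq1 mom0 mul1r.
rewrite (@sum_momentE (size s).+1)//.
rewrite [X in X + _](@sum_momentE (size s).+1)// !big_ord_recl !bin0 !mulr1 -addrA.
congr (_ + _).
rewrite (eq_bigr (fun k : 'I_(size s) => sum_coef k.+1 s * 'C(N, k.+1)%:R +
  sum_coef k.+1 s * 'C(N, k)%:R)); last first.
  by move=> k _; rewrite -mulrDr -natrD -binS.
rewrite big_split /=; congr (_ + _).
rewrite (bigID (fun p => 1 < size p.1)%N) /= [X in _ = _ + X]big1 ?addr0; last first.
  by move=> [[//|a [|//]] b] _ /=; rewrite mom1 mul0r.
rewrite [RHS](eq_bigl (fun p => 1 < size p.1)%N); last by move=> [[|a [|b c]] d].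
rewrite [RHS]big_seq_cond [RHS](eq_bigr (fun p =>
   \sum_(k < size s) mom p.1 * sum_coef k p.2 * 'C(N, k)%:R)); last first.
  move=> p /andP[ps p1]; have := size_splits ps => sp.
  rewrite (@sum_momentE (size s)); last first.
    by move: p1 sp; move: (size p.1) (size p.2) (size s) => a b c; lia.
  by rewrite mulr_sumr; apply: eq_bigr => k _; rewrite mulrA.
rewrite -big_seq_cond exchange_big /=; apply: eq_bigr => k _.
by rewrite mulr_suml.
Qed.

(* [N ^- l * 'C(N, k)] as a polynomial in [1 / N]. *)
Definition bin_poly (l k : nat) : {poly R} :=
  'X^(l - k) * \prod_(j < k) (1 - j%:R *: 'X) * (k`!%:R^-1)%:P.

(** The coefficient of [N ^- nu] in the moment divided by [N ^+ size s]. The sum stops at half the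
    length, past which [sum_coef] is zero. *)
Definition moment_coef (nu : nat) s : R :=
  \sum_(k < (size s)./2.+1) sum_coef k s * (bin_poly (size s) k)`_nu.

Lemma size_bin_poly l k : (k <= l)%N -> (size (bin_poly l k) <= l.+1)%N.
Proof.
move=> kl; apply: leq_trans (size_polyMleq _ _) _.
have h : (size (\prod_(j < k) (1 - (j%:R : R) *: 'X))%R <= k.+1)%N.
  elim: k kl => [|k IH] kl; first by rewrite big_ord0 size_poly1.
  rewrite big_ord_recr /= (leq_trans (size_polyMleq _ _))//.
  have : (size (1 - (k%:R : R) *: 'X)%R <= 2)%N.
    rewrite (leq_trans (size_polyD _ _))// geq_max size_poly1 /=.
    by rewrite size_polyN (leq_trans (size_scale_leq _ _))// size_polyX.
  have := IH (ltnW kl); move: (size _) (size _) => a b; lia.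
have : (size ('X^(l - k) * \prod_(j < k) (1 - (j%:R : R) *: 'X))%R <= l.+1)%N.
  apply: leq_trans (size_polyMleq _ _) _; rewrite size_polyXn.
  by move: (size _) h => a; lia.
have := size_polyC_leq1 (k`!%:R^-1 : R).
by move: (size _) (size _) => a b; lia.
Qed.

Lemma bin_poly_eval l k N : (k <= l)%N -> (0 < N)%N ->
  (bin_poly l k).[N%:R^-1] = N%:R ^- l * 'C(N, k)%:R.
Proof.
move=> kl N0; rewrite /bin_poly !hornerM hornerXn hornerC horner_prod.
have n0 : N%:R != 0 :> R by rewrite pnatr_eq0 -lt0n.
have f0 : k`!%:R != 0 :> R by rewrite pnatr_eq0 -lt0n fact_gt0.
apply: (@mulIf _ k`!%:R) => //; rewrite mulfVK// -mulrA -natrM bin_ffact.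
have -> : (N ^_ k)%:R = \prod_(j < k) (N%:R - j%:R) :> R.
  elim: k {kl f0} => [|k IH]; first by rewrite big_ord0.
  rewrite ffactnSr natrM IH big_ord_recr /=; have [kN|kN] := leqP k N.
    by rewrite natrB.
  (* For [k > N] the factor with [i = N] vanishes, as does the falling factorial. *)
  have -> : \prod_(i < k) (N%:R - i%:R) = 0 :> R.
    by rewrite (bigD1 (Ordinal kN)) //= subrr mul0r.
  by rewrite !mul0r.
rewrite -{2}(subnK kl) exprD invfM -mulrA exprVn; congr (_ * _).
(* Each factor of the falling factorial receives one [1 / N], since [(N - j) / N = 1 - j / N]. *)
rewrite -exprVn -[k in X in _ = X * _]card_ord -prodr_const -big_split /=.
apply: eq_bigr => j _; rewrite !hornerE.
by field.
Qed.

Lemma coef_bin_poly_lt l k nu : (nu < l - k)%N -> (bin_poly l k)`_nu = 0.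
Proof. by move=> h; rewrite /bin_poly -mulrA coefXnM h. Qed.

(** Every term has [k] at most half of [size s], so its polynomial in [1 / N] starts at the exponent
    [size s - k], which exceeds [nu]. This vanishing bounds the order of [L_nu] by 2 nu and gives
    the Taylor remainder of order 2n its size [N ^- n]. *)
Lemma moment_coef_lt nu s : (nu.*2 < size s)%N -> moment_coef nu s = 0.
Proof.
move=> h; apply: big1 => k _; rewrite coef_bin_poly_lt ?mulr0//.
by have := ltn_ord k; have := odd_double_half (size s); lia.
Qed.

(** An exact identity: the normalised moment is a polynomial in [1 / N] of degree at most [size s],
    which any range [K > size s] covers. *)
Lemma sum_moment_expansion N K s : (0 < N)%N -> (size s < K)%N ->
  N%:R ^- size s * sum_moment N s = \sum_(nu < K) N%:R ^- nu * moment_coef nu s.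
Proof.
move=> N0 sK; rewrite /sum_moment /moment_coef.
have h2 : ((size s)./2.+1 <= (size s).+1)%N by rewrite ltnS; lia.
have -> : \sum_(k < (size s).+1) sum_coef k s * 'C(N, k)%:R =
    \sum_(k < (size s)./2.+1) sum_coef k s * 'C(N, k)%:R.
  rewrite (big_ord_widen _ (fun k => sum_coef k s * 'C(N, k)%:R) h2).
  rewrite [LHS](bigID (fun k : 'I__ => (k < (size s)./2.+1)%N)) /= [X in _ + X]big1 ?addr0//.
  move=> k; rewrite -leqNgt => sk; rewrite sum_coef_eq0 ?mul0r//.
  by have := odd_double_half (size s); lia.
under [RHS]eq_bigr do rewrite mulr_sumr.
rewrite exchange_big /= mulr_sumr; apply: eq_bigr => k _.
have ks : (k <= size s)%N by have := ltn_ord k; lia.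
rewrite mulrCA -bin_poly_eval// (horner_coef_wide _ (leq_trans (size_bin_poly ks) sK)).
by rewrite mulr_sumr; apply: eq_bigr => nu _; rewrite exprVn; ring.
Qed.

Lemma moment_coef_nil nu : moment_coef nu [::] = (nu == 0)%:R.
Proof.
rewrite /moment_coef big_ord1 /= mul1r /bin_poly big_ord0 expr0 !mul1r fact0 invr1.
by rewrite coefC; case: nu.
Qed.

Lemma moment_coef1 nu i : moment_coef nu [:: i] = 0.
Proof. by rewrite /moment_coef big_ord1 /= mul0r. Qed.

Lemma moment_coef2 i j : moment_coef 1 [:: i; j] = mom [:: i; j].
Proof.
rewrite /moment_coef !big_ord_recr big_ord0 /= !mul0r !add0r.
rewrite !big_cons big_nil /= !addr0 mulr1.
rewrite /bin_poly big_ord1 scale0r subr0 mulr1 invr1 mulr1 coefXn.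
by rewrite mulr1.
Qed.

End moments.

(** * Integration against convolution powers *)

Lemma continuous_sum (R : realType) (U : topologicalType) (W : normedModType R)
    (I : Type) (r : seq I) (k : I -> U -> W) :
  (forall i, continuous (k i)) -> continuous (fun y => \sum_(i <- r) k i y).
Proof.
move=> ck; elim: r => [|i r IH] y.
  by under eq_fun do rewrite big_nil; exact: cst_continuous.
under eq_fun do rewrite big_cons; apply: continuousD; first exact: ck.
exact: IH.
Qed.

Section polytope.
Variables (R : realType) (m : nat) (P : set 'rV[R]_m).
Hypothesis polyP : polytope P.

Lemma polytope_convex (x y : 'rV[R]_m) (t : R) :
  P x -> P y -> 0 <= t <= 1 -> P (t *: x + (1 - t) *: y).
Proof.
have [k [v ->]] := polyP.
move=> [w [w0 w1 ->]] [z [z0 z1 ->]] /andP[t0 t1].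
exists (fun j => t * w j + (1 - t) * z j); split=> [j||].
- by rewrite addr_ge0 ?mulr_ge0 ?subr_ge0.
- by rewrite big_split /= -!mulr_sumr w1 z1 !mulr1 subrKC.
- rewrite !scaler_sumr -big_split /=; apply: eq_bigr => j _.
  by rewrite [RHS]scalerDl !scalerA.
Qed.

(** [P] is the continuous image of the standard simplex, which a closed equation cuts out of a
    compact cube. *)
Lemma polytope_compact : compact P.
Proof.
have [k [v ->]] := polyP.
pose comb (w : 'rV[R]_k) := \sum_j w 0 j *: v j.
have ccomb : continuous comb.
  apply: (continuous_sum (k := fun j (w : 'rV[R]_k) => w 0 j *: v j)) => j w.
  apply: (@continuous_comp _ _ _ (fun w : 'rV[R]_k => w 0 j) (fun c => c *: v j)).
    exact: coord_continuous.
  exact: scalel_continuous.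
pose total (w : 'rV[R]_k) := \sum_j w 0 j.
have ctotal : continuous total.
  apply: (continuous_sum (k := fun j (w : 'rV[R]_k) => w 0 j)) => j w.
  exact: coord_continuous.
have cube : compact [set w : 'rV[R]_k | forall j, `[0, 1]%classic (w 0 j)].
  by apply: (@rV_compact R k (fun=> `[0, 1]%classic)) => _; exact: segment_compact.
have cl : closed (total @^-1` [set 1]).
  by apply: closed_comp => [w _|]; [exact: ctotal|exact: closed_eq].
have := continuous_compact (continuous_subspaceT ccomb) (compact_closedI cube cl).
congr compact; apply/seteqP; split=> [_ [w [w01 w1] <-]|x [w [w0 w1 ->]]].
  by exists (fun j => w 0 j); split=> // j; have := w01 j; rewrite /= in_itv/= => /andP[].
exists (\row_j w j); last by apply: eq_bigr => j _; rewrite mxE.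
split=> [j|] /=; last by rewrite /total -[RHS]w1; apply: eq_bigr => j _; rewrite mxE.
rewrite mxE in_itv/= w0 -w1 (bigD1 j)//= lerDl; exact: sumr_ge0.
Qed.

End polytope.

Section integration.
Variables (R : realType) (m : nat).
Local Notation V := 'rV[R]_m.
Local Notation B := (Borel R m).
Implicit Types (D P : set V) (h g : V -> R) (mu nu : probability B R).

Lemma measurable_open_Borel D : open D -> measurable (D : set B).
Proof. exact: sub_sigma_algebra. Qed.

Lemma measurable_compact_Borel D : compact D -> measurable (D : set B).
Proof.
move=> cD; rewrite -[X in measurable X]setCK; apply: measurableC.
apply: measurable_open_Borel; rewrite openC.
by apply: compact_closed cD; exact: norm_hausdorff.
Qed.

Lemma measurable_continuous_Borel h :
  continuous h -> measurable_fun setT (h : B -> R).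
Proof.
move=> ch; apply: (measurability _ (RGenOpens.measurableE R)).
move=> _ [_ [a [b ->]] <-]; rewrite setTI; apply: measurable_open_Borel.
by apply: (@open_comp _ _ h) => [x _|]; [exact: ch|exact: interval_open].
Qed.

Lemma compact_fun_bounded D h : compact D -> {within D, continuous h} ->
  exists2 C : R, 0 < C & forall x, D x -> `|h x| <= C.
Proof.
move=> cD ch; have /compact_bounded[M [Mr HM]] := continuous_compact ch cD.
exists (`|M| + 1) => [|x Dx]; first by rewrite ltr_wpDl.
apply: HM; first by rewrite (le_lt_trans (ler_norm _))// ltrDl.
by exists x.
Qed.

Lemma integrable_continuous nu D h : compact D -> continuous h ->
  nu.-integrable D (EFin \o (h : B -> R)).
Proof.
move=> cD ch; apply: measurable_bounded_integrable.
- exact: measurable_compact_Borel.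
- by rewrite (le_lt_trans (probability_le1 _ _)) ?ltry//; exact: measurable_compact_Borel.
- by apply: measurable_funTS; exact: measurable_continuous_Borel.
- have [C C0 HC] := compact_fun_bounded cD (continuous_subspaceT ch).
  exists C; split=> [|M CM x Dx]; first exact: num_real.
  by apply: (le_trans (HC _ Dx)); exact: ltW.
Qed.

Lemma integral_full nu D (k : B -> \bar R) : measurable (D : set B) ->
  nu D = 1%E -> nu.-integrable setT k ->
  (\int[nu]_x k x = \int[nu]_(x in D) k x)%E.
Proof.
move=> mD D1 ik; rewrite (@negligible_integral _ _ _ nu _ (~` D : set B)) ?setTD ?setCK//.
  exact: measurableC.
by apply: etrans (probability_setC nu mD) _; rewrite D1 subee.
Qed.

Variable P : set V.
Hypotheses (cptP : compact P)
  (convP : forall (x y : V) (t : R), P x -> P y -> 0 <= t <= 1 ->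
     P (t *: x + (1 - t) *: y)) (P0 : P !=set0).

(** The N-fold convolution of a measure on [P] is carried by this compact set, where continuous
    functions are bounded and hence integrable. *)
Definition dilate (N : nat) : set V := [set N%:R *: p | p in P].

Lemma compact_dilate N : compact (dilate N).
Proof.
have h : continuous (fun p : V => (N%:R : R) *: p) by exact: scaler_continuous.
exact: (continuous_compact (continuous_subspaceT h) cptP).
Qed.

Lemma measurable_dilate N : measurable (dilate N : set B).
Proof. by apply: measurable_compact_Borel; exact: compact_dilate. Qed.

(** The sum [u + N p] is [N + 1] times the combination of [u] and [p] with weights [1 / (N + 1)] and
    [N / (N + 1)], which convexity keeps in [P]. *)
Lemma dilateS N u v : P u -> dilate N v -> dilate N.+1 (u + v).
Proof.
move=> Pu [p Pp <-].
exists (N.+1%:R^-1 *: u + (1 - N.+1%:R^-1) *: p).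
  by apply: convP => //; rewrite invr_ge0 ler0n invf_le1 ?ltr0n// ler1n.
have N0 : N.+1%:R != 0 :> R by rewrite pnatr_eq0.
rewrite scalerDr !scalerA mulrBr divff// scale1r mulr1 -natr1; congr (_ + _ *: _).
by rewrite addrK.
Qed.

Lemma dilate1 : dilate 1 = P.
Proof. by apply/seteqP; split=> [_ [p Pp <-]|p Pp]; [|exists p => //]; rewrite scale1r. Qed.

Lemma dilate0 : dilate 0 = [set 0].
Proof.
apply/seteqP; split=> [_ [p _ <-]|_ ->]; first by rewrite scale0r.
by have [p Pp] := P0; exists p => //; rewrite scale0r.
Qed.

Lemma dilate_divn N p : (0 < N)%N -> (P (N%:R^-1 *: p)) = dilate N p.
Proof.
move=> N0; have n0 : N%:R != 0 :> R by rewrite pnatr_eq0 -lt0n.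
apply/propext; split=> [h|[q Pq <-]].
  by exists (N%:R^-1 *: p) => //; rewrite scalerA divff// scale1r.
by rewrite scalerA mulVf// scale1r.
Qed.

Lemma convolution_power_dilate mu N : mu P = 1%E ->
  convolution_power mu N (dilate N) = 1%E.
Proof.
move=> mu1; elim: N => [|[|N] IH].
- rewrite dilate0; rewrite /= diracE.
  by rewrite mem_set.
- by rewrite dilate1.
- have mP : measurable (P : set B) by exact: measurable_compact_Borel.
  have mN := measurable_dilate N.+1.
  have E : (mu \x convolution_power mu N.+1)%E (P `*` dilate N.+1) = 1%E.
    apply: etrans (product_measure1E _ _ mP mN) _.
    by apply: etrans (congr2 mule mu1 IH) _; rewrite mul1e.
  apply/eqP; rewrite eq_le; apply/andP; split.
    by apply: probability_le1; exact: measurable_dilate.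
  rewrite -E; apply: le_measure.
  + by rewrite inE; apply: measurableX.
  + rewrite inE -[X in measurable X]setTI; apply: measurable_borel_add => //.
    exact: measurable_dilate.
  + by move=> [u v] /= [Pu Dv]; exact: dilateS.
Qed.

(** The expectation of [h] at the plain sum of [N] copies: the scaling by [1 / N] is postponed, as
    the recursion on [N] concerns the unscaled sum. *)
Definition conv_integral mu N h : R := \int[convolution_power mu N]_(y in dilate N) h y.

Section functional.
Variables (mu : probability B R) (N : nat).
Local Notation conv_integral := (conv_integral mu N).

Let mD := measurable_dilate N.
Let iD h : continuous h -> (convolution_power mu N).-integrable (dilate N) (EFin \o h).
Proof. exact/integrable_continuous/compact_dilate. Qed.

Lemma eq_Lam h g : (forall y, dilate N y -> h y = g y) -> conv_integral h = conv_integral g.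
Proof. by move=> hg; apply: eq_Rintegral => y /set_mem /hg. Qed.

Lemma conv_integralD h g : continuous h -> continuous g ->
  conv_integral (fun y => h y + g y) = conv_integral h + conv_integral g.
Proof. by move=> ch cg; apply: RintegralD => //; exact: iD. Qed.

Lemma conv_integralB h g : continuous h -> continuous g ->
  conv_integral (fun y => h y - g y) = conv_integral h - conv_integral g.
Proof. by move=> ch cg; apply: RintegralB => //; exact: iD. Qed.

Lemma conv_integralZ (c : R) h : continuous h -> conv_integral (fun y => c * h y) = c * conv_integral h.
Proof. by move=> ch; apply: RintegralZl => //; exact: iD. Qed.

Lemma conv_integral_le h g : continuous h -> continuous g ->
  (forall y, dilate N y -> h y <= g y) -> conv_integral h <= conv_integral g.
Proof. by move=> ch cg hg; apply: le_Rintegral => //; exact: iD. Qed.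

Lemma conv_integral_norm h : continuous h -> `|conv_integral h| <= conv_integral (fun y => `|h y|).
Proof. by move=> ch; apply: le_normr_Rintegral => //; exact: iD. Qed.

Lemma conv_integral_sum (I : Type) (r : seq I) (h : I -> V -> R) :
  (forall i, continuous (h i)) ->
  conv_integral (fun y => \sum_(i <- r) h i y) = \sum_(i <- r) conv_integral (h i).
Proof.
move=> ch; elim: r => [|i r IH].
  rewrite big_nil -[RHS](mul0r (conv_integral (fun=> 0))) -conv_integralZ.
    by apply: eq_Lam => y _; rewrite big_nil mul0r.
  by move=> y; exact: cst_continuous.
rewrite big_cons -IH -conv_integralD//.
  by apply: eq_Lam => y _; rewrite big_cons.
exact: continuous_sum.
Qed.

Hypothesis mu1 : mu P = 1%E.

Lemma conv_integral_cst (c : R) : conv_integral (fun=> c) = c.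
Proof.
rewrite /conv_integral Rintegral_cst; last exact: mD.
by rewrite [X in fine X](convolution_power_dilate N mu1) mulr1.
Qed.

Lemma conv_integral_bound h (C : R) : continuous h ->
  (forall y, dilate N y -> `|h y| <= C) -> `|conv_integral h| <= C.
Proof.
move=> ch hC; rewrite -[C]conv_integral_cst (le_trans (conv_integral_norm ch))// conv_integral_le//.
  by move=> y; apply: continuous_comp (ch y) _; exact: norm_continuous.
by move=> y; exact: cst_continuous.
Qed.

End functional.

Lemma conv_integral0 mu h : continuous h -> conv_integral mu 0 h = h 0.
Proof.
move=> ch; rewrite /conv_integral /Rintegral integral_dirac.
- by rewrite diracE dilate0 mem_set// mul1e.
- exact: measurable_dilate.
- by apply: measurable_funTS; apply/measurable_EFinP; exact: measurable_continuous_Borel.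
Qed.

Lemma conv_integral1 mu h : conv_integral mu 1 h = \int[mu]_(y in P) h y.
Proof. by rewrite /conv_integral dilate1. Qed.

Lemma bernstein_powerE mu N h : (0 < N)%N -> continuous h ->
  \int[bernstein_power mu N]_(z in P) h z = conv_integral mu N (fun y => h (N%:R^-1 *: y)).
Proof.
move=> N0 ch.
have E : @borel_scale R m N%:R^-1 @^-1` P = dilate N.
  by apply/funext => p; exact: dilate_divn.
rewrite /conv_integral /Rintegral /bernstein_power integral_pushforward ?E//.
- by apply/measurable_EFinP; exact: measurable_continuous_Borel.
- apply: (@integrable_continuous _ _ (fun y => h (N%:R^-1 *: y))).
    exact: compact_dilate.
  by move=> y; apply: continuous_comp; [exact: scaler_continuous|exact: ch].
- exact: measurable_compact_Borel.
Qed.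

Lemma integrable_bounded d (T : measurableType d) (nu : probability T R) (k : T -> R) (C : R) :
  measurable_fun setT k -> (forall x, `|k x| <= C) -> nu.-integrable setT (EFin \o k).
Proof.
move=> mk kC; apply: measurable_bounded_integrable => //.
  by rewrite (le_lt_trans (probability_le1 _ _)) ?ltry.
exists C; split=> [|M CM x _]; first exact: num_real.
by apply: (le_trans (kC x)); exact: ltW.
Qed.

Lemma conv_integralS mu N h : mu P = 1%E -> continuous h ->
  conv_integral mu N.+1 h = \int[mu]_(u in P) conv_integral mu N (fun v : V => h (u + v)).
Proof.
move=> mu1 ch; have mP : measurable (P : set B) by exact: measurable_compact_Borel.
have chu (u : V) : continuous (fun v : V => h (u + v)).
  move=> v; apply: continuous_comp; last exact: ch.
  by apply: continuousD; [exact: cst_continuous|exact: cvg_id].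
(* With one factor [convolution_power] is the measure itself, not a convolution with the Dirac mass
   at 0, so this case stands apart. *)
case: N => [|N].
  by rewrite conv_integral1; apply: eq_Rintegral => u _; rewrite conv_integral0// addr0.
set nu := convolution_power mu N.+1.
have mD := measurable_dilate N.+1; have mD' := measurable_dilate N.+2.
have D1 : nu (dilate N.+1) = 1%E by exact: convolution_power_dilate.
(* [h] may be unbounded. Cut off outside the support it is bounded, hence integrable on the whole
   product, and unchanged at the sums [u + v] that carry the mass. *)
pose k : B -> R := h \_ (dilate N.+2).
have mk : measurable_fun setT k.
  have mh := measurable_continuous_Borel ch.
  by apply: (measurable_restrictT _ mD').1; exact: (measurable_funTS mh).
have [C C0 hC] := compact_fun_bounded (@compact_dilate N.+2) (continuous_subspaceT ch).
have kC x : `|k x| <= C.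
  by rewrite /k patchE; case: ifPn => [/set_mem/hC//|_]; rewrite normr0 ltW.
have mK : measurable_fun setT (k \o @borel_add R m).
  by apply: measurableT_comp => //; exact: measurable_borel_add.
pose K := EFin \o (k \o @borel_add R m).
have iK : (mu \x nu)%E.-integrable setT K by exact: integrable_bounded (fun x => kC _).
have -> : conv_integral mu N.+2 h = fine (\int[(mu \x nu)%E]_z K z)%E.
  congr fine; rewrite /= integral_mkcond.
  rewrite (eq_integral (EFin \o k)); last first.
    by move=> x _ /=; rewrite /k !patchE; case: ifPn.
  rewrite integral_distribution//; first exact/measurable_EFinP.
rewrite -integral12_prod_meas1// (integral_full mP mu1); last first.
  exact: integrable_fubini_F.
congr fine; apply: eq_integral => u /set_mem Pu.
rewrite /fubini_F (integral_full mD D1); last first.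
  apply: (@integrable_bounded _ _ _ (fun v : B => k (borel_add (u, v))) C).
    by have := measurableT_comp mK (measurable_pair1 u); exact.
  by move=> v; exact: kC.
rewrite /conv_integral /Rintegral fineK.
  apply: eq_integral => v /set_mem Dv.
  by rewrite /K /k /= patchE mem_set//; exact: dilateS.
by apply: integrable_fin_num => //; apply: integrable_continuous => //; exact: compact_dilate.
Qed.

End integration.

Lemma continuous_nearP (R : realType) (W : topologicalType) (g : W -> R) (x : W) :
  {for x, continuous g} <->
  forall e : R, 0 < e -> \forall y \near x, `|g y - g x| <= e.
Proof.
split=> [/cvgrPdist_le h e /h|h].
  by apply: filterS => y; rewrite distrC.
by apply/cvgrPdist_le => e /h; apply: filterS => y; rewrite distrC.
Qed.

Lemma continuous_fst_for (W W' U : topologicalType) (g : W -> U) (x : W) (y : W') :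
  {for x, continuous g} -> {for (x, y), continuous (fun p : W * W' => g p.1)}.
Proof.
move=> cg A /cg xA; exists (g @^-1` A, setT); first by split=> //; exact: filterT.
by move=> [p q] [].
Qed.

Lemma continuous_snd_for (W W' U : topologicalType) (g : W' -> U) (x : W) (y : W') :
  {for y, continuous g} -> {for (x, y), continuous (fun p : W * W' => g p.2)}.
Proof.
move=> cg A /cg xA; exists (setT, g @^-1` A); first by split=> //; exact: filterT.
by move=> [p q] [].
Qed.

Lemma near_line (R : realType) (W : normedModType R) (x e : W) (U : set W) :
  nbhs x U -> exists2 c : R, 0 < c & forall t : R, `|t| < c -> U (x + t *: e).
Proof.
move=> /nbhs_ballP[d /= d0 dU].
have n0 : 0 < `|e| + 1 by rewrite ltr_wpDl.
exists (d / (`|e| + 1)) => [|t td]; first exact: divr_gt0.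
apply: dU; rewrite -ball_normE /= opprD addrA subrr add0r normrN normrZ.
rewrite (le_lt_trans (_ : _ <= `|t| * (`|e| + 1)))//; last by rewrite -ltr_pdivlMr.
by rewrite ler_wpM2l// lerDl.
Qed.

Lemma eq_is_derive_on (R : realType) (W : normedModType R) (U : set W)
    (g h : W -> R) (x v : W) (l : R) :
  open U -> U x -> (forall y, U y -> g y = h y) ->
  is_derive x v g l -> is_derive x v h l.
Proof.
move=> oU Ux gh; apply: near_eq_is_derive.
by apply: filterS (open_nbhs_nbhs (conj oU Ux)) => y /gh.
Qed.

(** * Calculus of remainders *)

Section decay.
Variables (R : realType) (T : Type) (D : set T).
Implicit Types (e : nat -> T -> R) (g h : T -> R).

Definition bounded_by_const g : Prop := exists C : R, forall x, D x -> `|g x| <= C.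

(** The bound holds from [N = 1] on, so that estimates combine without thresholds. *)
Definition decay (n : nat) e : Prop :=
  exists C : R, forall N x, (0 < N)%N -> D x -> `|e N x| <= C * N%:R ^- n.

Lemma bounded_by_constD g h : bounded_by_const g -> bounded_by_const h ->
  bounded_by_const (fun x => g x + h x).
Proof.
move=> [C HC] [C' HC']; exists (C + C') => x Dx.
by rewrite (le_trans (ler_normD _ _))// lerD ?HC ?HC'.
Qed.

Lemma bounded_by_constM g h : bounded_by_const g -> bounded_by_const h ->
  bounded_by_const (fun x => g x * h x).
Proof.
move=> [C HC] [C' HC']; exists (C * C') => x Dx.
by rewrite normrM ler_pM ?HC ?HC'.
Qed.

Lemma bounded_by_const_cst (c : R) : bounded_by_const (fun=> c).
Proof. by exists `|c|. Qed.

Lemma bounded_by_const_sum (I : Type) (r : seq I) (g : I -> T -> R) :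
  (forall a, bounded_by_const (g a)) ->
  bounded_by_const (fun x => \sum_(a <- r) g a x).
Proof.
move=> bg; elim: r => [|a r IH].
  by exists 0 => x _; rewrite big_nil normr0.
have [C HC] := bounded_by_constD (bg a) IH.
by exists C => x Dx; rewrite big_cons; exact: HC.
Qed.

Lemma decayD n e e' : decay n e -> decay n e' -> decay n (fun N x => e N x + e' N x).
Proof.
move=> [C HC] [C' HC']; exists (C + C') => N x N0 Dx.
by rewrite mulrDl (le_trans (ler_normD _ _))// lerD ?HC ?HC'.
Qed.

Lemma decayM n g e : bounded_by_const g -> decay n e -> decay n (fun N x => g x * e N x).
Proof.
move=> [C HC] [C' HC']; exists (C * C') => N x N0 Dx.
by rewrite -mulrA normrM ler_pM ?HC ?HC'.
Qed.

Lemma decay_eq n e e' : (forall N x, (0 < N)%N -> D x -> e N x = e' N x) ->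
  decay n e -> decay n e'.
Proof. by move=> ee [C HC]; exists C => N x N0 Dx; rewrite -ee// HC. Qed.

Lemma decay_le n e e' : (forall N x, (0 < N)%N -> D x -> `|e N x| <= e' N x) ->
  decay n e' -> decay n e.
Proof.
move=> ee [C HC]; exists C => N x N0 Dx.
by rewrite (le_trans (ee _ _ N0 Dx))// (le_trans (ler_norm _))// HC.
Qed.

Lemma decay0 n : decay n (fun _ _ => 0).
Proof. by exists 0 => N x _ _; rewrite normr0 mul0r. Qed.

Lemma decay_sum n (I : Type) (r : seq I) (e : I -> nat -> T -> R) :
  (forall a, decay n (e a)) -> decay n (fun N x => \sum_(a <- r) e a N x).
Proof.
move=> oe; elim: r => [|a r IH].
  by apply: decay_eq (decay0 n) => N x _ _; rewrite big_nil.
by apply: decay_eq (decayD (oe a) IH) => N x _ _; rewrite big_cons.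
Qed.

Lemma decay_term n nu g : (n <= nu)%N -> bounded_by_const g ->
  decay n (fun N x => N%:R ^- nu * g x).
Proof.
move=> nnu [C HC]; exists C => N x N0 Dx.
rewrite normrM mulrC ler_pM ?HC//.
rewrite ger0_norm ?invr_ge0 ?exprn_ge0// lef_pV2 ?posrE ?exprn_gt0 ?ltr0n//.
by rewrite ler_weXn2l// ler1n.
Qed.

(** Differentiation brings out a factor [N]; one order of decay is its price. *)
Lemma decay_scale n e : decay n.+1 e -> decay n (fun N x => N%:R * e N x).
Proof.
move=> [C HC]; exists C => N x N0 Dx.
have n0 : 0 < N%:R :> R by rewrite ltr0n.
rewrite normrM normr_nat -(ler_pdivlMl _ _ n0) (le_trans (HC _ _ N0 Dx))//.
by rewrite exprS invfM mulrCA.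
Qed.

End decay.

(** The largest coordinate dominates every factor. Pure powers are a useful majorant: with an even
    exponent the absolute values disappear, and the expectations are moments. *)
Lemma monomial_le (R : realType) (m : nat) (s : seq 'I_m) (y : 'rV[R]_m) :
  (0 < size s)%N -> `|monomial s y| <= \sum_i `|y 0 i| ^+ size s.
Proof.
case: s => [//|i0 s] _; case: (@arg_maxP _ R _ i0 xpredT (fun i => `|y 0 i|) isT).
move=> j _ jmax.
have : `|monomial (i0 :: s) y| <= `|y 0 j| ^+ size (i0 :: s).
  elim: (i0 :: s) => [|i t IH]; first by rewrite /monomial big_nil normr1.
  by rewrite /monomial big_cons normrM exprS; apply: ler_pM => //; exact: jmax.
by move=> h; apply: le_trans h _; rewrite (bigD1 j)//= lerDl sumr_ge0.
Qed.

Lemma monomial_nseq (R : realType) (m k : nat) (i : 'I_m) (y : 'rV[R]_m) :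
  monomial (nseq k i) y = y 0 i ^+ k.
Proof.
by elim: k => [|k IH]; rewrite /monomial /= ?big_nil// big_cons -/(monomial _ _) IH exprS.
Qed.

Lemma ler_add_invn (R : realType) (a b D : R) :
  (forall N : nat, (0 < N)%N -> a <= b + D * N%:R^-1) -> a <= b.
Proof.
move=> H; apply/ler_addgt0Pr => e e0.
have D1 : 0 < `|D| + 1 by rewrite ltr_wpDl.
have /ltr_add_invr[n] : 0 < e / (`|D| + 1) by exact: divr_gt0.
rewrite add0r ltr_pdivlMr// mulrC => ne.
apply: le_trans (H n.+1 isT) _; rewrite lerD2l (le_trans _ (ltW ne))//.
by rewrite ler_wpM2r// (le_trans (ler_norm D))// lerDl.
Qed.

(** Differentiation of a uniform limit along a line. The mean value theorem is applied to [g N]; for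
    fixed [t] the errors of order [1 / N] disappear as [N] grows, and only the oscillation of [b]
    near [x] remains. *)
Lemma is_derive_limit (R : realType) (W : normedModType R) (g dg : nat -> W -> R)
    (a b : W -> R) (x v : W) (d C : R) : 0 < d ->
  (forall N (s : R), (0 < N)%N -> `|s| < d ->
     is_derive (x + s *: v) v (g N) (dg N (x + s *: v))) ->
  (forall N (s : R), (0 < N)%N -> `|s| < d ->
     `|g N (x + s *: v) - a (x + s *: v)| <= C * N%:R^-1) ->
  (forall N (s : R), (0 < N)%N -> `|s| < d ->
     `|dg N (x + s *: v) - b (x + s *: v)| <= C * N%:R^-1) ->
  {for x, continuous b} -> is_derive x v a (b x).
Proof.
move=> d0 dgd ga dgb cb; apply/is_deriveP_eps => e e0.
have [c c0 Hc] := near_line v ((continuous_nearP _ _).1 cb e e0).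
exists (Num.min d c) => [|t]; first by rewrite lt_min d0.
rewrite lt_min => /andP[td tc].
apply: (@ler_add_invn _ _ _ (C + C + `|t| * C)) => N N0.
have [s st E] : exists2 s : R, `|s| <= `|t| & g N (x + t *: v) - g N x = t * dg N (x + s *: v).
  apply: (MVT_dir (dg := dg N)) => s st; apply: dgd => //; exact: le_lt_trans td.
have sd := le_lt_trans st td.
have -> : a (x + t *: v) - a x - t * b x =
    - (g N (x + t *: v) - a (x + t *: v)) + (g N x - a x) +
    t * (dg N (x + s *: v) - b (x + s *: v)) + t * (b (x + s *: v) - b x).
  by rewrite mulrBr -E; ring.
have g0 : `|g N x - a x| <= C * N%:R^-1.
  by have := ga N 0 N0; rewrite normr0 scale0r addr0; exact.
apply: le_trans (ler_normD _ _) _.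
rewrite [leRHS](_ : _ = (C * N%:R^-1 + C * N%:R^-1 + `|t| * (C * N%:R^-1)) + `|t| * e); last by ring.
apply: lerD; last first.
  by rewrite normrM ler_wpM2l//; exact: Hc (le_lt_trans st tc).
apply: le_trans (ler_normD _ _) _; apply: lerD; last by rewrite normrM ler_wpM2l// dgb.
apply: le_trans (ler_normD _ _) _; apply: lerD => //.
by rewrite normrN ga.
Qed.

Lemma is_derive_bigsum (R : realType) (W : normedModType R) (I : Type) (r : seq I) (g : I -> W -> R)
    (dg : I -> R) (x v : W) :
  (forall a, is_derive x v (g a) (dg a)) ->
  is_derive x v (fun y => \sum_(a <- r) g a y) (\sum_(a <- r) dg a).
Proof.
move=> H; elim: r => [|a r IH].
  rewrite big_nil (_ : (fun _ => _) = fun=> 0); first exact: is_derive_cst.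
  by apply/funext => y; rewrite big_nil.
rewrite big_cons (_ : (fun _ => _) = fun y => g a y + \sum_(b <- r) g b y).
  exact: is_deriveD (H a) IH.
by apply/funext => y; rewrite big_cons.
Qed.

(** * Complex-valued functions and multi-indices *)

Section complex_parts.
Variable R : realType.
Implicit Types (a b c d : R) (z : R[i]).

Lemma Complex_eta z : z = Complex (complex.Re z) (complex.Im z).
Proof. by case: z. Qed.

Lemma ComplexB a b c d : Complex a b - Complex c d = Complex (a - c) (b - d) :> R[i].
Proof. by []. Qed.

Lemma Complex_sum (I : Type) (r : seq I) (F G : I -> R) :
  \sum_(i <- r) Complex (F i) (G i) = Complex (\sum_(i <- r) F i) (\sum_(i <- r) G i) :> R[i].
Proof.
elim: r => [|i r IH]; first by rewrite !big_nil.
by rewrite !big_cons IH.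
Qed.

Lemma real_complexM a b c : real_complex R a * Complex b c = Complex (a * b) (a * c) :> R[i].
Proof. by apply/eqP; rewrite eq_complex /= !mul0r subr0 addr0 !eqxx. Qed.

Lemma natVX_complexM (N nu : nat) b c :
  N%:R ^- nu * Complex b c = Complex (N%:R ^- nu * b) (N%:R ^- nu * c) :> R[i].
Proof.
by rewrite -real_complexM fmorphV rmorphXn rmorph_nat.
Qed.

Lemma normc_le a b : Normc.normc (Complex a b) <= `|a| + `|b|.
Proof.
rewrite /= -[leRHS]ger0_norm ?addr_ge0// -sqrtr_sqr ler_wsqrtr// sqrrD.
by rewrite !real_normK ?num_real// addrAC lerDl mulrn_wge0// mulr_ge0.
Qed.

End complex_parts.

Section multi_index.
Variables (R : realType) (m : nat).
Local Notation V := 'rV[R]_m.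
Implicit Types (f : V -> R[i]) (al : 'I_m -> nat) (s : seq 'I_m) (g : V -> R).

Definition sorted_word al : seq 'I_m := flatten [seq nseq (al i) i | i <- enum 'I_m].

Lemma iter_cpartial n (i : 'I_m) g g' :
  iter n (cpartial i) (fun x => Complex (g x) (g' x)) =
  fun x => Complex (partials (nseq n i) g x) (partials (nseq n i) g' x).
Proof. by elim: n => [|n IH] //=; rewrite IH. Qed.

Lemma cderivE al f :
  cderiv al f = fun x => Complex (partials (sorted_word al) (@complex.Re R \o f) x)
                                 (partials (sorted_word al) (@complex.Im R \o f) x).
Proof.
rewrite /cderiv /sorted_word; elim: (enum 'I_m) => [|i r IH] /=.
  by apply/funext => x; rewrite -Complex_eta.
by rewrite IH iter_cpartial /partials !foldr_cat.
Qed.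

Lemma count_sorted_word al i : count_mem i (sorted_word al) = al i.
Proof.
suff H r : uniq r -> count_mem i (flatten [seq nseq (al j) j | j <- r]) =
    if i \in r then al i else 0%N by rewrite H ?enum_uniq// mem_enum.
elim: r => //= j r IH /andP[jr ur]; rewrite count_cat IH// count_nseq /=.
have [->|ij] := eqVneq i j; first by rewrite inE eqxx (negbTE jr) mul1n addn0.
by rewrite inE (negbTE ij).
Qed.

Lemma perm_sorted_word al s : (forall i, count_mem i s = al i) -> perm_eq s (sorted_word al).
Proof.
by move=> H; apply/allP => i _ /=; rewrite H count_sorted_word.
Qed.

Lemma sum_count_mem s : (\sum_(i < m) count_mem i s)%N = size s.
Proof.
elim: s => [|j s IH]; first by rewrite big1.
rewrite /= big_split /= IH (bigD1 j)//= eqxx big1 ?addn0// => i ij.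
by rewrite eq_sym (negbTE ij).
Qed.

Definition has_counts k (al : multi_index m k) s := [forall i, count_mem i s == val al i].

(** Exactly one multi-index counts the letters of a word of length at most [k], so the sum has a
    single term. *)
Lemma sum_has_counts k s (F : multi_index m k -> R) (c : R) : (size s <= k)%N ->
  (forall al : multi_index m k, has_counts al s -> F al = c) ->
  \sum_(al : multi_index m k | has_counts al s) F al = c.
Proof.
move=> sk Fc; pose a0 : {ffun 'I_m -> 'I_k.+1} := [ffun i => inord (count_mem i s)].
have a0E i : a0 i = count_mem i s :> nat.
  by rewrite ffunE inordK// ltnS (leq_trans (count_size _ _)).
have a0P : (\sum_i a0 i <= k)%N.
  by under eq_bigr do rewrite a0E; rewrite sum_count_mem.
pose al0 : multi_index m k := exist _ a0 a0P.
have al0c : has_counts al0 s by apply/forallP => i; rewrite a0E.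
rewrite (big_pred1 al0); first exact: Fc.
move=> al; apply/idP/eqP => [/forallP H|->//].
by apply/val_inj/ffunP => i; apply/val_inj; rewrite /= a0E; apply/esym/eqP/H.
Qed.

End multi_index.

(** * Bernstein measures *)

Section bernstein_calculus.
Variables (R : realType) (m : nat) (P : set 'rV[R]_m).
Local Notation V := 'rV[R]_m.
Variables (B : V -> probability (Borel R m) R) (K : V -> 'M[R]_m).
Hypotheses (polyP : polytope P) (intP : P° !=set0) (bernB : bernstein_measure P B K).
Implicit Types (h f : V -> R) (x y u v : V) (i j : 'I_m).

Let cptP : compact P := polytope_compact polyP.
Let convP := polytope_convex polyP.

Lemma interior_sub x : P° x -> P x.
Proof. exact: interior_subset. Qed.

Let P0 : P !=set0.
Proof. by have [p /interior_sub] := intP; exists p. Qed.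

Let oP : open P°.
Proof. exact: open_interior. Qed.

Lemma near_interior x : P° x -> \forall y \near x, P° y.
Proof. by move=> Px; exact: open_nbhs_nbhs. Qed.

Local Notation E x h := (conv_integral P (B x) 1 h).

Let E1 x : P x -> B x P = 1%E.
Proof. exact: bernstein_supp bernB x. Qed.

Let ccont h : continuous h -> ccontinuous_on P (fun z : V => Complex (h z) 0).
Proof.
move=> ch; split; first exact: continuous_subspaceT.
by apply: continuous_subspaceT => z; exact: cst_continuous.
Qed.

Let EE h : (fun x : V => E x h) = (fun x : V => \int[B x]_(z in P) h z).
Proof. by apply/funext => x; rewrite conv_integral1. Qed.

Lemma expectation_smooth h : continuous h -> smooth_on P° (fun x : V => E x h).
Proof.
by move=> /ccont /(bernstein_smooth bernB)[[+ _] _]; rewrite EE.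
Qed.

Lemma expectation_continuous h : continuous h -> {within P, continuous (fun x : V => E x h)}.
Proof.
by move=> /ccont /(bernstein_smooth bernB)[_ [+ _]]; rewrite EE.
Qed.

Lemma continuousM_coord h j : continuous h -> continuous (fun z : V => z 0 j * h z).
Proof. by move=> ch z; apply: continuousM; [exact: coord_continuous|exact: ch]. Qed.

Lemma continuous_scale (c : R) h : continuous h -> continuous (fun z : V => c * h z).
Proof. by move=> ch z; apply: continuousM; [exact: cst_continuous|exact: ch]. Qed.

Lemma continuous_add h f : continuous h -> continuous f ->
  continuous (fun z : V => h z + f z).
Proof. by move=> ch cf z; apply: continuousD; [exact: ch|exact: cf]. Qed.

Lemma continuous_sub h f : continuous h -> continuous f ->
  continuous (fun z : V => h z - f z).
Proof. by move=> ch cf z; apply: continuousB; [exact: ch|exact: cf]. Qed.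

Lemma continuous_mul h f : continuous h -> continuous f ->
  continuous (fun z : V => h z * f z).
Proof. by move=> ch cf z; apply: continuousM; [exact: ch|exact: cf]. Qed.

(** The factor [z - x] is expanded so that every integrand is free of [x]: the right-hand side is
    then made of expectations of the same kind. *)
Lemma expectation_partial h x i : continuous h -> P° x ->
  is_derive x (delta_mx 0 i) (fun x : V => E x h)
    (\sum_j K x i j * (E x (fun z : V => z 0 j * h z) - x 0 j * E x h)).
Proof.
move=> ch Px.
have := bernstein_gradient bernB (ccont ch) Px i.
move=> /(congr1 (@complex.Re R)) /= G.
have d := is_derive_partial i (expectation_smooth ch) Px.
apply: (is_derive_eq d).
rewrite EE [LHS]G -conv_integral1.
transitivity (E x (fun z : V => \sum_j (K x i j * (z 0 j * h z) + - (K x i j * x 0 j) * h z))).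
  apply: eq_Lam => z _; rewrite /= mulr0 subr0 mxE mulr_sumr.
  by apply: eq_bigr => j _; rewrite !mxE; ring.
rewrite conv_integral_sum//; last first.
  by move=> j; apply: continuous_add; apply: continuous_scale; last exact: ch;
    exact: continuousM_coord.
apply: eq_bigr => j _; rewrite conv_integralD//; last 2 first.
- by apply: continuous_scale; exact: continuousM_coord.
- exact: continuous_scale.
rewrite !conv_integralZ//; first by ring.
exact: continuousM_coord.
Qed.

Lemma expectation_coord x i : P x -> E x (fun z : V => z 0 i) = x 0 i.
Proof.
by move=> Px; rewrite conv_integral1 [in RHS](bernstein_barycenter bernB Px) mxE.
Qed.

Lemma continuous_addl h u : continuous h -> continuous (fun v : V => h (u + v)).
Proof.
move=> ch v; apply: continuous_comp; last exact: ch.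
by apply: continuousD; [exact: cst_continuous|exact: cvg_id].
Qed.

Lemma expectationS N x h : P x -> continuous h ->
  conv_integral P (B x) N.+1 h = E x (fun u : V => conv_integral P (B x) N (fun v : V => h (u + v))).
Proof. by move=> Px ch; rewrite conv_integral1 -conv_integralS//; exact: E1. Qed.

(** * Joint continuity and gradients of expectations under convolution powers *)

Lemma tube (F : V * V -> R) (D : set V) x0 : compact D ->
  (forall u, D u -> {for (x0, u), continuous F}) ->
  forall e : R, 0 < e -> \forall y \near x0, forall u, D u -> `|F (y, u) - F (x0, u)| <= e.
Proof.
move=> /compact_near_coveringP cD cF e e0.
apply: (cD _ (nbhs x0) (fun y u => `|F (y, u) - F (x0, u)| <= e)) => u Du.
have e2 : 0 < e / 2 by rewrite divr_gt0.
have /cvgrPdist_le/(_ _ e2)[[U U'] /= [xU uU'] sub] := cF u Du.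
exists (U', U) => //= -[u' y] /= [U'u' Uy].
have h1 := sub (y, u') (conj Uy U'u').
have h2 := sub (x0, u') (conj (nbhs_singleton xU) U'u').
rewrite -(subrKA (F (x0, u))) (splitr e) (le_trans (ler_normD _ _))// lerD//.
by rewrite distrC.
Qed.

(** Uniformity in [x] comes from the support: all these probabilities are carried by the same
    compact [dilate P N], on which a small shift changes [h] little. *)
Lemma shift_near N h u0 (e : R) : continuous h -> 0 < e ->
  \forall u \near u0, forall x, P x ->
    `|conv_integral P (B x) N (fun v : V => h (u + v)) - conv_integral P (B x) N (fun v : V => h (u0 + v))| <= e.
Proof.
move=> ch e0.
have cD : compact (dilate P N) by exact: compact_dilate.
have ct u : dilate P N u -> {for (u0, u), continuous (fun p : V * V => h (p.1 + p.2))}.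
  move=> _; apply: continuous_comp; last exact: ch.
  by apply: continuousD; [exact: cvg_fst|exact: cvg_snd].
apply: filterS (tube cD ct e0) => u Hu x Px.
rewrite -conv_integralB//; try exact: continuous_addl.
apply: (conv_integral_bound cptP convP P0 (E1 Px)) => //.
by move=> z; apply: continuousB; exact: continuous_addl.
Qed.

Lemma conv_integral_shift_continuous N h x : P x -> continuous h ->
  continuous (fun u : V => conv_integral P (B x) N (fun v : V => h (u + v))).
Proof.
move=> Px ch u0; apply/continuous_nearP => e e0.
by apply: filterS (shift_near N u0 ch e0) => u /(_ _ Px).
Qed.

(** Both the measure and the integrand move. With the integrand frozen at [x0] the expectation is
    continuous in its point; the change of integrand is small uniformly on [P], and integration
    against a probability does not enlarge it. *)
Lemma expectation_joint_continuous (F : V * V -> R) x0 : P° x0 ->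
  (forall u, P u -> {for (x0, u), continuous F}) ->
  (forall y, P° y -> continuous (fun u : V => F (y, u))) ->
  {for (x0, x0), continuous (fun p : V * V => E p.1 (fun u : V => F (p.2, u)))}.
Proof.
move=> Px0 cF cFu; apply/continuous_nearP => e e0.
have e2 : 0 < e / 2 by rewrite divr_gt0.
have cE := smooth_on_continuous (expectation_smooth (cFu _ Px0)) Px0.
have N1 := filterI (near_interior Px0) ((continuous_nearP _ _).1 cE _ e2).
have N2 := filterI (near_interior Px0) (tube cptP cF e2).
exists ([set x | P° x] `&`
    [set x | `|E x (fun u => F (x0, u)) - E x0 (fun u => F (x0, u))| <= e / 2],
  [set y | P° y] `&` [set y | forall u, P u -> `|F (y, u) - F (x0, u)| <= e / 2]).
  by split; [exact: N1|exact: N2].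
move=> [x y] /= [[Px h1] [Py h2]].
rewrite -(subrKA (E x (fun u => F (x0, u)))) (splitr e) (le_trans (ler_normD _ _))// lerD//.
rewrite -conv_integralB//; try exact: cFu.
apply: (conv_integral_bound cptP convP P0 (E1 (interior_sub Px))).
  by move=> z; apply: continuousB; exact: cFu.
by move=> u; rewrite dilate1 => Pu; exact: h2.
Qed.

(** Continuity in [x] is assumed for the one shift [u0], a premise that the induction of
    [conv_integral_continuous] can supply. *)
Lemma conv_integral_joint_continuous_aux N h x0 u0 : P° x0 -> continuous h ->
  {for x0, continuous (fun x : V => conv_integral P (B x) N (fun v : V => h (u0 + v)))} ->
  {for (x0, u0), continuous (fun p : V * V => conv_integral P (B p.1) N (fun v : V => h (p.2 + v)))}.
Proof.
move=> Px0 ch cx; apply/continuous_nearP => e e0.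
have e2 : 0 < e / 2 by rewrite divr_gt0.
have N1 := filterI (near_interior Px0) ((continuous_nearP _ _).1 cx _ e2).
exists ([set x | P° x] `&` [set x | `|conv_integral P (B x) N (fun v => h (u0 + v)) -
      conv_integral P (B x0) N (fun v => h (u0 + v))| <= e / 2],
  [set u | forall x, P x ->
    `|conv_integral P (B x) N (fun v => h (u + v)) - conv_integral P (B x) N (fun v => h (u0 + v))| <= e / 2]).
  by split; [exact: N1|exact: shift_near].
move=> [x u] /= [[Px h1] h2].
rewrite -(subrKA (conv_integral P (B x) N (fun v => h (u0 + v)))) (splitr e).
by rewrite (le_trans (ler_normD _ _))// lerD//; apply: h2; exact: interior_sub.
Qed.

(** For [N + 1] copies this is a one-fold expectation whose integrand also depends on [x]; its joint
    continuity is restricted to the diagonal. *)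
Lemma conv_integral_continuous N h x0 : P° x0 -> continuous h ->
  {for x0, continuous (fun x : V => conv_integral P (B x) N h)}.
Proof.
elim: N h x0 => [|N IH] h x0 Px0 ch.
  apply: (smooth_on_continuous _ Px0).
  apply: eq_smooth_on oP _ (@smooth_on_cst _ _ _ (h 0)) => y _.
  by rewrite (conv_integral0 cptP P0 _ ch).
have J := expectation_joint_continuous (F := fun p => conv_integral P (B p.1) N (fun v => h (p.2 + v))) Px0.
have {}J := J (fun u _ => conv_integral_joint_continuous_aux (N:=N) (u0:=u) Px0 ch
  (IH _ _ Px0 (@continuous_addl _ u ch))).
have {}J := J (fun y Py => @conv_integral_shift_continuous N _ _ (interior_sub Py) ch).
apply/continuous_nearP => e e0.
have [[U U'] /= [xU xU'] sub] := (continuous_nearP _ _).1 J e e0.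
apply: filterS (filterI (near_interior Px0) (filterI xU xU')) => x [Px [Ux U'x]].
have := sub (x, x) (conj Ux U'x).
by rewrite (expectationS _ (interior_sub Px) ch) (expectationS _ (interior_sub Px0) ch).
Qed.

Lemma conv_integral_joint_continuous N h x0 u0 : P° x0 -> continuous h ->
  {for (x0, u0), continuous (fun p : V * V => conv_integral P (B p.1) N (fun v => h (p.2 + v)))}.
Proof.
move=> Px0 ch; apply: conv_integral_joint_continuous_aux => //.
by apply: conv_integral_continuous => //; exact: continuous_addl.
Qed.

(** The i-th component of the expectation of [h(S_N)] weighted by [K x] applied to [S_N - N x],
    where [S_N] is the sum of [N] copies. *)
Definition conv_grad N h x i : R :=
  \sum_j K x i j *
    (conv_integral P (B x) N (fun z => z 0 j * h z) - N%:R * x 0 j * conv_integral P (B x) N h).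

(** With the shift absorbed into the weight, the function [z_j h(z)] is taken at [u + v], so
    continuity in the shift follows from that of plain expectations. *)
Lemma conv_grad_shift N h x i u : continuous h ->
  conv_grad N (fun v => h (u + v)) x i =
  \sum_j K x i j * (conv_integral P (B x) N (fun v => (u + v) 0 j * h (u + v)) -
    (u 0 j + N%:R * x 0 j) * conv_integral P (B x) N (fun v => h (u + v))).
Proof.
move=> ch; apply: eq_bigr => j _; congr (_ * _).
have cs := @continuous_addl _ u ch.
have -> : conv_integral P (B x) N (fun v : V => (u + v) 0 j * h (u + v)) =
    u 0 j * conv_integral P (B x) N (fun v : V => h (u + v)) +
    conv_integral P (B x) N (fun v : V => v 0 j * h (u + v)).
  rewrite -conv_integralZ// -conv_integralD//.
  - by apply: eq_Lam => v _; rewrite mxE mulrDl.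
  - exact: continuous_scale.
  - exact: continuousM_coord cs.
by ring.
Qed.

Lemma defining_continuous x i j : P° x -> {for x, continuous (fun x : V => K x i j)}.
Proof. by move=> Px; exact: smooth_on_continuous (defining_smooth bernB i j) Px. Qed.

Lemma continuous_for_sum (U : topologicalType) (I : Type) (r : seq I)
    (F : I -> U -> R) (z : U) :
  (forall a, {for z, continuous (F a)}) ->
  {for z, continuous (fun y : U => \sum_(a <- r) F a y)}.
Proof.
move=> cF; elim: r => [|a r IH]; rewrite /prop_for /continuous_at.
  by under eq_fun do rewrite big_nil; rewrite big_nil; exact: cst_continuous.
under eq_fun do rewrite big_cons; rewrite big_cons.
exact: continuousD (cF a) IH.
Qed.

Lemma conv_grad_joint_continuous N h x0 u0 i : P° x0 -> continuous h ->
  {for (x0, u0), continuous (fun p : V * V => conv_grad N (fun v => h (p.2 + v)) p.1 i)}.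
Proof.
move=> Px0 ch; rewrite (_ : (fun p : V * V => _) = (fun p : V * V =>
  \sum_j K p.1 i j * (conv_integral P (B p.1) N (fun v => (p.2 + v) 0 j * h (p.2 + v)) -
    (p.2 0 j + N%:R * p.1 0 j) * conv_integral P (B p.1) N (fun v => h (p.2 + v))))); last first.
  by apply/funext => p; exact: conv_grad_shift.
have cc j : continuous (fun u : V => u 0 j) by exact: coord_continuous.
apply: continuous_for_sum => j; apply: continuousM.
  exact: (continuous_fst_for (g := fun x : V => K x i j) (defining_continuous Px0)).
apply: continuousB.
  exact: (conv_integral_joint_continuous (h := fun z => z 0 j * h z) Px0 (continuousM_coord ch)).
apply: continuousM; last exact: conv_integral_joint_continuous.
apply: continuousD; first exact: (continuous_snd_for (g := fun u : V => u 0 j) (cc j u0)).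
apply: continuousM; first exact: cst_continuous.
exact: (continuous_fst_for (g := fun u : V => u 0 j) (cc j x0)).
Qed.

Lemma conv_grad_shift_continuous N h x i : P x -> continuous h ->
  continuous (fun u : V => conv_grad N (fun v => h (u + v)) x i).
Proof.
move=> Px ch; rewrite (_ : (fun u : V => _) = (fun u : V =>
  \sum_j K x i j * (conv_integral P (B x) N (fun v => (u + v) 0 j * h (u + v)) -
    (u 0 j + N%:R * x 0 j) * conv_integral P (B x) N (fun v => h (u + v))))); last first.
  by apply/funext => u; exact: conv_grad_shift.
apply: continuous_sum => j; apply: continuous_scale; apply: continuous_sub.
  exact: (conv_integral_shift_continuous (h := fun z => z 0 j * h z) Px (continuousM_coord ch)).
apply: continuous_mul; last exact: conv_integral_shift_continuous.
apply: continuous_add; first by exact: coord_continuous.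
by move=> u; exact: cst_continuous.
Qed.

(** Only the inner measure moves. For each [u] the increment is [t] times a gradient at a nearby
    point, and compactness of [P] makes it close to the gradient at [x] uniformly in [u]. *)
Lemma derive_under_expectation N h x i : P° x -> continuous h ->
  (forall y u, P° y -> is_derive y (delta_mx 0 i)
     (fun x : V => conv_integral P (B x) N (fun v => h (u + v)))
     (conv_grad N (fun v => h (u + v)) y i)) ->
  is_derive (0 : R) 1 (fun t : R => E x (fun u =>
      conv_integral P (B (x + t *: delta_mx 0 i)) N (fun v => h (u + v))))
    (E x (fun u => conv_grad N (fun v => h (u + v)) x i)).
Proof.
move=> Px ch dL; set e := delta_mx 0 i; apply/is_deriveP_eps => eps eps0.
have T := @filterI _ _ (nbhs_filter x) _ _ (near_interior Px) (tube (D := P) cptP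
  (fun u _ => @conv_grad_joint_continuous N h x u i Px ch) eps0).
have [c c0 Hc] := near_line e T.
exists c => // t tc; rewrite !add0r scaler1 scale0r addr0.
have Pxt := interior_sub (Hc t tc).1.
have cf y : P y -> continuous (fun u : V => conv_integral P (B y) N (fun v => h (u + v))).
  by move=> Py; exact: conv_integral_shift_continuous.
have cd : continuous (fun u : V => t * conv_grad N (fun v => h (u + v)) x i).
  by apply: continuous_scale; exact: conv_grad_shift_continuous (interior_sub Px) ch.
have Px' := interior_sub Px.
have cB : continuous (fun u : V => conv_integral P (B (x + t *: e)) N (fun v => h (u + v)) -
    conv_integral P (B x) N (fun v => h (u + v))).
  by apply: continuous_sub; exact: cf.
rewrite -conv_integralZ//; last exact: conv_grad_shift_continuous.
rewrite -conv_integralB; [|exact: cptP|exact: cf|exact: cf].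
rewrite -conv_integralB//.
apply: (conv_integral_bound cptP convP P0 (E1 Px')).
  by apply: continuous_sub; [exact: cB|exact: cd].
move=> u; rewrite dilate1 => Pu.
have [s st ->] : exists2 s : R, `|s| <= `|t| &
    conv_integral P (B (x + t *: e)) N (fun v => h (u + v)) - conv_integral P (B x) N (fun v => h (u + v)) =
    t * conv_grad N (fun v => h (u + v)) (x + s *: e) i.
  apply: (MVT_dir (g := fun x => conv_integral P (B x) N (fun v => h (u + v)))
    (dg := fun y => conv_grad N (fun v => h (u + v)) y i)) => s st.
  by apply: dL; exact: (Hc s (le_lt_trans st tc)).1.
rewrite -mulrBr normrM mulrC ler_wpM2r//.
exact: (Hc s (le_lt_trans st tc)).2.
Qed.

(* [S_{N+1}] is [u + v] with [u] distributed as [B x] and [v] as [S_N]: the two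
   occurrences of [x] are differentiated separately and merged by [is_derive_diag]. *)
Lemma conv_integral_partial N h x i : P° x -> continuous h ->
  is_derive x (delta_mx 0 i) (fun x : V => conv_integral P (B x) N h) (conv_grad N h x i).
Proof.
elim: N h x => [|N IH] h x Px ch.
  apply: (eq_is_derive_on (g := fun=> h 0) oP Px) => [y _|]; first by rewrite (conv_integral0 cptP P0).
  rewrite (_ : conv_grad _ _ _ _ = 0); first exact: is_derive_cst.
  apply: big1 => j _; rewrite (conv_integral0 cptP P0); last exact: continuousM_coord.
  by rewrite mxE !mul0r subrr mulr0.
pose f y (u : V) := conv_integral P (B y) N (fun v => h (u + v)).
have cf y : P y -> continuous (f y).
  by move=> Py; exact: (conv_integral_shift_continuous Py ch).
have EQ y : P° y -> E y (f y) = conv_integral P (B y) N.+1 h.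
  by move=> /interior_sub Py; rewrite (expectationS _ Py ch).
have Px' := interior_sub Px.
(* The derivative in the point [p.1] of the outer measure, the point [p.2] of the integrand being
   held fixed. *)
pose dE (p : V * V) := \sum_j K p.1 i j *
  (E p.1 (fun u => u 0 j * f p.2 u) - p.1 0 j * E p.1 (f p.2)).
pose g (a b : R) := dE (x + a *: delta_mx 0 i, x + b *: delta_mx 0 i).
have [d d0 Hd] := near_line (delta_mx 0 i) (near_interior Px).
have cj j : continuous (fun u : V => u 0 j) by exact: coord_continuous.
have cdE : {for (x, x), continuous dE}.
  have cF u : {for (x, u), continuous (fun p : V * V => f p.1 p.2)}.
    exact: (@conv_integral_joint_continuous N h x u Px ch).
  apply: continuous_for_sum => j; apply: continuousM.
    exact: (continuous_fst_for (g := fun x : V => K x i j) (defining_continuous Px)).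
  apply: continuousB.
    apply: (expectation_joint_continuous
      (F := fun p : V * V => p.2 0 j * f p.1 p.2) Px) => [u _|y Py].
      apply: continuousM; last exact: cF.
      exact: (continuous_snd_for (g := fun u : V => u 0 j) (cj j u)).
    exact: continuousM_coord (cf _ (interior_sub Py)).
  apply: continuousM.
    exact: (continuous_fst_for (g := fun u : V => u 0 j) (cj j x)).
  apply: (expectation_joint_continuous
    (F := fun p : V * V => f p.1 p.2) Px) => [u _|y Py]; first exact: cF.
  exact: cf (interior_sub Py).
(* The two contributions add up because [(u - x) + (v - N x) = (u + v) - (N + 1) x]. *)
have Dg : conv_grad N.+1 h x i = g 0 0 + E x (fun u => conv_grad N (fun v => h (u + v)) x i).
  pose Q j (u : V) := conv_integral P (B x) N (fun v => (u + v) 0 j * h (u + v)).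
  have cQ j : continuous (Q j).
    exact: (conv_integral_shift_continuous
      (h := fun z => z 0 j * h z) Px' (continuousM_coord ch)).
  have cfx := cf _ Px'.
  have cuf j : continuous (fun u : V => u 0 j * f x u) by exact: continuousM_coord.
  have -> : E x (fun u => conv_grad N (fun v => h (u + v)) x i) =
      \sum_j K x i j * (E x (Q j) - (E x (fun u => u 0 j * f x u) + N%:R * x 0 j * E x (f x))).
    transitivity (E x (fun u => \sum_j K x i j *
        (Q j u - (u 0 j * f x u + N%:R * x 0 j * f x u)))).
      by apply: eq_Lam => u _; rewrite conv_grad_shift//; apply: eq_bigr => j _; rewrite mulrDl.
    have c1 j : continuous (fun u : V => u 0 j * f x u + N%:R * x 0 j * f x u).
      by apply: continuous_add => //; exact: continuous_scale.
    have c2 j : continuous (fun u : V => Q j u - (u 0 j * f x u + N%:R * x 0 j * f x u)).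
      exact: continuous_sub.
    rewrite conv_integral_sum//; last by move=> j; exact: continuous_scale.
    apply: eq_bigr => j _; rewrite conv_integralZ// conv_integralB// conv_integralD//; last exact: continuous_scale.
    by rewrite conv_integralZ.
  rewrite /g /dE !scale0r addr0 -big_split /=; apply: eq_bigr => j _.
  rewrite -(EQ x Px).
  rewrite (expectationS N (h := fun z => z 0 j * h z) Px' (continuousM_coord ch)).
  have lin (k a p q r n : R) :
    k * (p - (n + 1) * a * r) = k * (q - a * r) + k * (p - (q + n * a * r)) by ring.
  by rewrite -/(Q j) -natr1; exact: lin.
have D1 : is_derive (0 : R) 1 (fun t : R => E x (f (x + t *: delta_mx 0 i)))
    (E x (fun u => conv_grad N (fun v => h (u + v)) x i)).
  apply: (derive_under_expectation Px ch) => y u Py.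
  exact: (IH (fun v => h (u + v)) y Py (@continuous_addl h u ch)).
pose H (a b : R) := E (x + a *: delta_mx 0 i) (f (x + b *: delta_mx 0 i)).
have D3 : is_derive (0 : R) 1 (fun t : R => H t t) (conv_grad N.+1 h x i).
  rewrite Dg; apply: (is_derive_diag d0).
  - move=> a b ad bd.
    have Q := expectation_partial i (cf _ (interior_sub (Hd b bd))) (Hd a ad).
    exact: ((is_derive_line (fun y => E y (f (x + b *: delta_mx 0 i))) _ _ _ a).1 Q).
  - move=> eps eps0; have [[U U'] /= [xU xU'] sub] := (continuous_nearP _ _).1 cdE eps eps0.
    have [c c0 Hc] := near_line (delta_mx 0 i) xU.
    have [c' c'0 Hc'] := near_line (delta_mx 0 i) xU'.
    exists (Num.min c c') => [|a b]; first by rewrite lt_min c0.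
    rewrite !lt_min => /andP[ac _] /andP[_ bc].
    rewrite /g !scale0r addr0.
    exact: (sub (_, _) (conj (Hc _ ac) (Hc' _ bc))).
  - by rewrite /H scale0r addr0.
have D2 : is_derive x (delta_mx 0 i) (fun y => E y (f y)) (conv_grad N.+1 h x i).
  by have := (is_derive_line (fun y : V => E y (f y)) x (delta_mx 0 i) _ 0).2 D3;
    rewrite scale0r addr0.
exact: (eq_is_derive_on oP Px EQ D2).
Qed.

Definition bernstein_real (N : nat) x f : R := conv_integral P (B x) N (fun y => f (N%:R^-1 *: y)).

Lemma continuous_scale_comp (c : R) f :
  continuous f -> continuous (fun y : V => f (c *: y)).
Proof.
by move=> cf y; apply: continuous_comp; [exact: scaler_continuous|exact: cf].
Qed.

Definition bernstein_real_grad (N : nat) x f i : R :=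
  N%:R * \sum_j K x i j * (bernstein_real N x (fun z => z 0 j * f z) - x 0 j * bernstein_real N x f).

(** The factor [N] comes from the scaling: [S_N - N x = N (S_N / N - x)]. *)
Lemma bernstein_real_partial N f x i : (0 < N)%N -> P° x -> continuous f ->
  is_derive x (delta_mx 0 i) (fun x : V => bernstein_real N x f) (bernstein_real_grad N x f i).
Proof.
move=> N0 Px cf; have cfN := @continuous_scale_comp N%:R^-1 f cf.
have n0 : N%:R != 0 :> R by rewrite pnatr_eq0 -lt0n.
rewrite (_ : bernstein_real_grad N x f i = conv_grad N (fun y => f (N%:R^-1 *: y)) x i).
  exact: conv_integral_partial.
rewrite /bernstein_real_grad mulr_sumr; apply: eq_bigr => j _; rewrite mulrCA; congr (_ * _).
rewrite mulrBr mulrA; congr (_ - _); rewrite -conv_integralZ//.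
  by apply: eq_Lam => y _; rewrite mxE !mulrA divff// mul1r.
exact: (continuous_scale_comp (f := fun z => z 0 j * f z) (continuousM_coord cf)).
Qed.

(** The gradient is again built from [K], the coordinates and Bernstein integrals of continuous
    functions, so smoothness bootstraps from the continuity of [f]. *)
Lemma bernstein_real_smooth N f : (0 < N)%N -> continuous f -> smooth_on P° (fun x => bernstein_real N x f).
Proof.
move=> N0 cf; apply/smooth_onP => k; elim: k f cf => [|k IH] f cf.
  apply: smooth_upto0 => x Px; split=> [|i]; last by have [] := bernstein_real_partial i N0 Px cf.
  exact: (conv_integral_continuous Px (@continuous_scale_comp N%:R^-1 f cf)).
apply/smooth_uptoS; split=> [|i]; first exact: smooth_upto_le (IH f cf).
have smK j : smooth_upto k P° (fun x => K x i j).
  by have /smooth_onP := defining_smooth bernB i j; exact.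
have smc j : smooth_upto k P° (fun x : V => x 0 j).
  by have /smooth_onP := @smooth_on_coord R m P° j; exact.
have smN : smooth_upto k P° (fun=> N%:R : R).
  by have /smooth_onP := @smooth_on_cst R m P° N%:R; exact.
have smN1 : smooth_upto k P° (fun=> -1 : R).
  by have /smooth_onP := @smooth_on_cst R m P° (-1); exact.
apply: (@eq_smooth_upto _ _ P° (fun x => bernstein_real_grad N x f i) _ k oP).
  by move=> x Px; have [_ <-] := bernstein_real_partial i N0 Px cf.
apply: (smooth_uptoM oP smN); apply: (smooth_upto_sum _ oP) => j.
apply: (smooth_uptoM oP (smK j)).
apply: (smooth_uptoD oP (IH _ (continuousM_coord cf))).
rewrite (_ : (fun x : V => _) = (fun x => (-1) * (x 0 j * bernstein_real N x f))); last first.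
  by apply/funext => x; rewrite mulN1r.
by apply: (smooth_uptoM oP smN1); exact: (smooth_uptoM oP (smc j) (IH f cf)).
Qed.

(** * The uniform expansion *)

Definition moment x s : R := E x (fun z => monomial s (z - x)).

Lemma continuous_monomial s (c : R) x : continuous (fun z : V => monomial s (c *: z - x)).
Proof.
elim: s => [|i s IH].
  rewrite (_ : (fun _ => _) = fun=> 1); first by move=> z; exact: cst_continuous.
  by apply/funext => z; rewrite /monomial big_nil.
rewrite (_ : (fun _ => _) = fun z : V => (c *: z - x) 0 i * monomial s (c *: z - x)).
  apply: continuous_mul IH.
  rewrite (_ : (fun _ => _) = fun z : V => c * z 0 i - x 0 i); last first.
    by apply/funext => z; rewrite !mxE.
  apply: continuous_sub => z; last exact: cst_continuous.
  by apply: continuous_scale; exact: coord_continuous.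
by apply/funext => z; rewrite /monomial big_cons.
Qed.

Lemma continuous_monomial1 s x : continuous (fun z : V => monomial s (z - x)).
Proof.
rewrite (_ : (fun _ => _) = fun z : V => monomial s (1 *: z - x)).
  exact: continuous_monomial.
by apply/funext => z; rewrite scale1r.
Qed.

Lemma moment_nil x : P x -> moment x [::] = 1.
Proof.
move=> Px; rewrite /moment -[RHS](conv_integral_cst cptP convP P0 1 (E1 Px)).
by apply: eq_Lam => z _; rewrite /monomial big_nil.
Qed.

Lemma moment1 x i : P x -> moment x [:: i] = 0.
Proof.
move=> Px; rewrite /moment.
transitivity (E x (fun z => z 0 i - x 0 i)).
  by apply: eq_Lam => z _; rewrite /monomial big_seq1 !mxE.
rewrite conv_integralB//; last 2 first.
- by move=> z; exact: coord_continuous.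
- by move=> z; exact: cst_continuous.
by rewrite (expectation_coord)// (conv_integral_cst cptP convP P0 1 (E1 Px)) subrr.
Qed.

(** Since [u + v - (N + 1) x] is [(u - x) + (v - N x)], expanding the monomial over [splits] yields
    the recursion of [sum_momentS], with the same value at [N = 0]. *)
Lemma conv_integral_monomial N x s : P x ->
  conv_integral P (B x) N (fun y => monomial s (y - N%:R *: x)) = sum_moment (moment x) N s.
Proof.
move=> Px; elim: N s => [|N IH] s.
  rewrite (conv_integral0 cptP P0); last exact: continuous_monomial1.
  rewrite scale0r subr0 sum_moment0; case: s => [|i s]; first by rewrite /monomial big_nil.
  by rewrite /monomial big_cons mxE mul0r.
rewrite (expectationS N Px); last exact: continuous_monomial1.
rewrite (sum_momentS (moment_nil Px) (fun i => moment1 i Px)).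
transitivity (E x (fun u => \sum_(p <- splits s) sum_moment (moment x) N p.2 *
    monomial p.1 (u - x))).
  apply: eq_Lam => u _.
  transitivity (conv_integral P (B x) N (fun v => \sum_(p <- splits s) monomial p.1 (u - x) *
      monomial p.2 (v - N%:R *: x))).
    apply: eq_Lam => v _; rewrite -prod_splits; apply: eq_bigr => i _.
    by rewrite -natr1 !mxE; ring.
  rewrite conv_integral_sum//; last first.
    by move=> p; apply: continuous_scale; exact: continuous_monomial1.
  apply: eq_bigr => p _; rewrite conv_integralZ//; last exact: continuous_monomial1.
  by rewrite IH mulrC.
rewrite conv_integral_sum//; last first.
  by move=> p; apply: continuous_scale; exact: continuous_monomial1.
apply: eq_bigr => p _; rewrite conv_integralZ//; last exact: continuous_monomial1.
by rewrite mulrC.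
Qed.

Lemma monomialZ (c : R) s y : monomial s (c *: y) = c ^+ size s * monomial s y.
Proof.
elim: s => [|i s IH]; first by rewrite /monomial !big_nil mul1r.
by rewrite /monomial !big_cons -/(monomial s y) -/(monomial s (c *: y)) IH mxE /= exprS; ring.
Qed.

Lemma bernstein_real_monomial N x s K0 : P x -> (0 < N)%N -> (size s < K0)%N ->
  bernstein_real N x (fun z => monomial s (z - x)) =
  \sum_(nu < K0) N%:R ^- nu * moment_coef (moment x) nu s.
Proof.
move=> Px N0 sK; rewrite -sum_moment_expansion// -conv_integral_monomial// -conv_integralZ//.
  apply: eq_Lam => y _; rewrite -exprVn -monomialZ scalerBr scalerA mulVf ?scale1r//.
  by rewrite pnatr_eq0 -lt0n.
exact: continuous_monomial1.
Qed.

(** The regularity asked of the coefficients of a differential operator; with [P] compact it also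
    makes them bounded. *)
Definition boundary_smooth g : Prop := {within P, continuous g} /\ smooth_on P° g.

Lemma boundary_smoothD g h : boundary_smooth g -> boundary_smooth h -> boundary_smooth (fun x => g x + h x).
Proof.
move=> [cg sg] [ch sh]; split; last exact: smooth_onD.
by move=> x; apply: continuousD; [exact: cg|exact: ch].
Qed.

Lemma boundary_smoothM g h : boundary_smooth g -> boundary_smooth h -> boundary_smooth (fun x => g x * h x).
Proof.
move=> [cg sg] [ch sh]; split; last exact: smooth_onM.
by move=> x; apply: continuousM; [exact: cg|exact: ch].
Qed.

Lemma boundary_smooth_cst (c : R) : boundary_smooth (fun=> c).
Proof. by split; [move=> x; exact: cst_continuous|exact: smooth_on_cst]. Qed.

Lemma boundary_smooth_sum (I : Type) (r : seq I) (Q : pred I) (G : I -> V -> R) :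
  (forall a, Q a -> boundary_smooth (G a)) -> boundary_smooth (fun x => \sum_(a <- r | Q a) G a x).
Proof.
move=> gG; elim: r => [|a r IH].
  by under eq_fun do rewrite big_nil; exact: boundary_smooth_cst.
under eq_fun do rewrite big_cons.
by case: (boolP (Q a)) => [Qa|_]; [exact: boundary_smoothD (gG a Qa) IH|exact: IH].
Qed.

Lemma boundary_smooth_coord i : boundary_smooth (fun x => x 0 i).
Proof.
split; last exact: smooth_on_coord.
by apply: continuous_subspaceT => x; exact: coord_continuous.
Qed.

Lemma boundary_smooth_bounded g : boundary_smooth g -> bounded_by_const P g.
Proof. by move=> [cg _]; have [C _ HC] := compact_fun_bounded cptP cg; exists C. Qed.

Lemma boundary_smooth_moment s : boundary_smooth (moment ^~ s).
Proof.
(* The integrand depends on [x] through [z - x]. One letter is expanded at a time and its [z] part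
   goes into [f], hence the generality in [f]. *)
suff H f : continuous f -> boundary_smooth (fun x => E x (fun z => f z * monomial s (z - x))).
  have c1 : continuous ((fun=> 1) : V -> R) by move=> z; exact: cst_continuous.
  rewrite (_ : moment ^~ s = fun x => E x (fun z => 1 * monomial s (z - x))).
    exact: H.
  by apply/funext => x; apply: eq_Lam => z _; rewrite mul1r.
elim: s f => [|i s IH] f cf.
  rewrite (_ : (fun _ => _) = fun x => E x f); last first.
    by apply/funext => x; apply: eq_Lam => z _; rewrite /monomial big_nil mulr1.
  by split; [exact: (expectation_continuous cf)|exact: (expectation_smooth cf)].
rewrite (_ : (fun _ => _) = fun x => E x (fun z => (z 0 i * f z) * monomial s (z - x)) +
    (-1) * (x 0 i * E x (fun z => f z * monomial s (z - x)))).
  apply: boundary_smoothD; first exact: IH (continuousM_coord cf).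
  apply: boundary_smoothM; first exact: boundary_smooth_cst.
  by apply: boundary_smoothM; [exact: boundary_smooth_coord|exact: IH].
apply/funext => x; have cm := continuous_mul cf (@continuous_monomial1 s x).
rewrite mulN1r -conv_integralZ// -conv_integralB//.
- apply: eq_Lam => z _; rewrite /monomial big_cons !mxE; ring.
- exact: continuous_mul (continuousM_coord cf) (@continuous_monomial1 s x).
- exact: continuous_scale.
Qed.

Lemma boundary_smooth_sum_coef k s : boundary_smooth (fun x => sum_coef (moment x) k s).
Proof.
elim: k s => [|k IH] s /=; first exact: boundary_smooth_cst.
by apply: boundary_smooth_sum => p _; apply: boundary_smoothM; [exact: boundary_smooth_moment|exact: IH].
Qed.

Lemma boundary_smooth_moment_coef nu s : boundary_smooth (fun x => moment_coef (moment x) nu s).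
Proof.
by apply: boundary_smooth_sum => k _; apply: boundary_smoothM; [exact: boundary_smooth_sum_coef|exact: boundary_smooth_cst].
Qed.

Local Notation coefficient nu s x := (moment_coef (moment x) nu s).

(** [L_nu] on real functions, indexed by words; by [moment_coef_lt] words longer than 2 nu would
    contribute zero. *)
Definition expansion_term (nu : nat) f x : R :=
  \sum_(k < nu.*2.+1) k`!%:R^-1 *
    \sum_(s <- words m k) coefficient nu s x * partials s f x.

Lemma expansion_term_widen nu K0 f x : (nu.*2 < K0)%N ->
  expansion_term nu f x = \sum_(k < K0) k`!%:R^-1 *
    \sum_(s <- words m k) coefficient nu s x * partials s f x.
Proof.
move=> nK; rewrite /expansion_term.
pose G k := k`!%:R^-1 * \sum_(s <- words m k) coefficient nu s x * partials s f x.
rewrite (big_ord_widen _ G nK) big_mkcond /=; apply: eq_bigr => k _.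
case: ifPn => //; rewrite -leqNgt => nk.
rewrite big_seq big1 ?mulr0// => s; rewrite mem_words => /eqP sk.
by rewrite moment_coef_lt ?mul0r// sk.
Qed.

Lemma partials_bounded f n : smooth_on setT f ->
  exists2 C : R, 0 <= C & forall s x, size s = n -> P x -> `|partials s f x| <= C.
Proof.
move=> sf.
have H s : exists2 C : R, 0 < C & forall x, P x -> `|partials s f x| <= C.
  apply: compact_fun_bounded cptP _; apply: continuous_subspaceT => x.
  exact: smooth_on_continuous (smooth_on_partials s sf) I.
suff [C C0 HC] : exists2 C : R, 0 <= C & forall s x, s \in words m n -> P x -> `|partials s f x| <= C.
  by exists C => // s x sn Px; apply: HC => //; rewrite mem_words sn.
elim: (words m n) => [|s r [C C0 HC]]; first by exists 0.
have [C' C'0 HC'] := H s; exists (C + C') => [|t x]; first by rewrite addr_ge0// ltW.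
rewrite inE => /predU1P[->|tr] Px.
  by rewrite (le_trans (HC' _ Px))// lerDr.
by rewrite (le_trans (HC _ _ tr Px))// lerDl ltW.
Qed.

Definition taylor_poly M f x z : R :=
  \sum_(k < M) k`!%:R^-1 * taylor_form k f x (z - x).

Lemma continuous_taylor_poly M f x : continuous (taylor_poly M f x).
Proof.
apply: continuous_sum => k; apply: continuous_scale.
rewrite /taylor_form; apply: continuous_sum => s.
rewrite (_ : (fun _ => _) = fun z => partials s f x * monomial s (z - x)).
  by apply: continuous_scale; exact: continuous_monomial1.
by apply/funext => z; rewrite mulrC.
Qed.

Lemma bernstein_real_sum N x (I : Type) (r : seq I) (F : I -> V -> R) :
  (forall a, continuous (F a)) ->
  bernstein_real N x (fun z => \sum_(a <- r) F a z) = \sum_(a <- r) bernstein_real N x (F a).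
Proof.
by move=> cF; rewrite /bernstein_real conv_integral_sum// => a; exact: continuous_scale_comp.
Qed.

Lemma bernstein_realZ N x (c : R) f : continuous f ->
  bernstein_real N x (fun z => c * f z) = c * bernstein_real N x f.
Proof. by move=> cf; rewrite /bernstein_real conv_integralZ//; exact: continuous_scale_comp. Qed.

Lemma bernstein_realB N x f g : continuous f -> continuous g ->
  bernstein_real N x (fun z => f z - g z) = bernstein_real N x f - bernstein_real N x g.
Proof. by move=> cf cg; rewrite /bernstein_real conv_integralB//; exact: continuous_scale_comp. Qed.

Lemma bernstein_real_le N x f g : (0 < N)%N -> continuous f -> continuous g ->
  (forall z, P z -> `|f z| <= g z) -> `|bernstein_real N x f| <= bernstein_real N x g.
Proof.
move=> N0 cf cg fg; have cfN := @continuous_scale_comp N%:R^-1 f cf.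
rewrite /bernstein_real (le_trans (conv_integral_norm cptP _ _ cfN))//.
apply: conv_integral_le => //.
- by move=> y; apply: continuous_comp (cfN y) _; exact: norm_continuous.
- exact: continuous_scale_comp.
- by move=> y; rewrite -dilate_divn// => /fg.
Qed.

Lemma bernstein_real_taylor_poly M N f x : P x -> (0 < N)%N ->
  bernstein_real N x (taylor_poly M f x) = \sum_(nu < M) N%:R ^- nu *
    \sum_(k < M) k`!%:R^-1 * \sum_(s <- words m k) coefficient nu s x * partials s f x.
Proof.
move=> Px N0; have cm s := @continuous_monomial1 s x.
rewrite /taylor_poly bernstein_real_sum; last first.
  move=> k; apply: continuous_scale; apply: continuous_sum => s.
  rewrite (_ : (fun _ => _) = fun z => partials s f x * monomial s (z - x)).
    exact: continuous_scale.
  by apply/funext => z; rewrite mulrC.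
under [RHS]eq_bigr do rewrite mulr_sumr.
rewrite exchange_big /=; apply: eq_bigr => k _.
transitivity (k`!%:R^-1 * \sum_(s <- words m k) partials s f x * bernstein_real N x (fun z => monomial s (z - x))).
  rewrite bernstein_realZ; last first.
    apply: continuous_sum => s.
    rewrite (_ : (fun _ => _) = fun z => partials s f x * monomial s (z - x)).
      exact: continuous_scale.
    by apply/funext => z; rewrite mulrC.
  congr (_ * _).
  transitivity (bernstein_real N x (fun z => \sum_(s <- words m k) partials s f x * monomial s (z - x))).
    by apply: eq_Lam => y _; apply: eq_bigr => s _; rewrite mulrC.
  rewrite bernstein_real_sum; last by move=> s; exact: continuous_scale.
  by apply: eq_bigr => s _; rewrite bernstein_realZ.
transitivity (k`!%:R^-1 * \sum_(s <- words m k) partials s f x *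
    \sum_(nu < M) N%:R ^- nu * coefficient nu s x).
  congr (_ * _); apply: eq_big_seq => s; rewrite mem_words => /eqP sk.
  by rewrite (bernstein_real_monomial (K0 := M))// sk.
under [RHS]eq_bigr do rewrite mulrCA.
rewrite -mulr_sumr; congr (_ * _).
under [RHS]eq_bigr do rewrite mulr_sumr.
rewrite exchange_big /=; apply: eq_bigr => s _; rewrite mulr_sumr.
by apply: eq_bigr => nu _; rewrite mulrCA; congr (_ * _); exact: mulrC.
Qed.

Lemma segment_sub x z (t : R) : P x -> P z -> 0 <= t <= 1 -> P (x + t *: (z - x)).
Proof.
move=> Px Pz t01; have := convP Pz Px t01; congr (P _).
by rewrite scalerBr scalerBl scale1r addrCA.
Qed.

(** The even order 2n allows a majorant made of pure powers, whose normalised moments have no term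
    below [N ^- n]. *)
Lemma taylor_remainder_decay n f : smooth_on setT f -> (0 < n)%N ->
  decay P n (fun N x => bernstein_real N x (fun z => f z - taylor_poly n.*2 f x z)).
Proof.
move=> sf n0.
have cf : continuous f by move=> x; exact: smooth_on_continuous sf I.
have [C C0 HC] := partials_bounded n.*2 sf.
(* The bound for the derivatives of order 2n, times the number of words of that length. *)
pose W : R := C * (size (words m n.*2))%:R.
have oS : decay P n (fun N x => W * \sum_i \sum_(nu < n.*2.+1)
    N%:R ^- nu * coefficient nu (nseq n.*2 i) x).
  apply: decayM; first exact: bounded_by_const_cst.
  apply: decay_sum => i; apply: decay_sum => nu.
  have [nnu|nun] := leqP n nu.
    exact: decay_term nnu (boundary_smooth_bounded (boundary_smooth_moment_coef nu _)).
  apply: decay_eq (decay0 _ _ n) => N x _ _.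
  by rewrite moment_coef_lt ?mulr0// size_nseq ltn_double.
apply: decay_le oS => N x N0 Px.
have cb : continuous (fun z : V => W * \sum_i monomial (nseq n.*2 i) (z - x)).
  by apply: continuous_scale; apply: continuous_sum => i; exact: continuous_monomial1.
have ct := @continuous_taylor_poly n.*2 f x.
apply: le_trans (bernstein_real_le (g := fun z => W * \sum_i monomial (nseq n.*2 i) (z - x)) x N0
  (continuous_sub cf ct) cb _) _.
  move=> z Pz.
  (* [taylor_expansion] at index q has q + 1 terms and a remainder of order q + 1, hence the
     predecessor. *)
  have n2 : n.*2.-1.+1 = n.*2 by rewrite prednK// double_gt0.
  have T := @taylor_expansion R m f x (z - x) n.*2.-1 C sf.
  rewrite n2 subrKC in T.
  apply: le_trans (T _) _.
    by move=> t s t01 ss; apply: HC => //; exact: segment_sub.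
  rewrite /W -mulrA ler_wpM2l// mulr_natl.
  have bnd s : s \in words m n.*2 ->
      `|monomial s (z - x)| <= \sum_i monomial (nseq n.*2 i) (z - x).
    rewrite mem_words => /eqP sn.
    apply: le_trans (monomial_le _ _) _; first by rewrite sn double_gt0.
    rewrite sn; apply: ler_sum => i _.
    by rewrite monomial_nseq -mul2n !exprM real_normK ?num_real.
  apply: (@le_trans _ _ (\sum_(s <- words m n.*2) \sum_i monomial (nseq n.*2 i) (z - x))).
    by rewrite big_seq [leRHS]big_seq; exact: ler_sum.
  by rewrite big_const_seq count_predT iter_addr_0.
rewrite bernstein_realZ; last by apply: continuous_sum => i; exact: continuous_monomial1.
rewrite bernstein_real_sum; last by move=> i; exact: continuous_monomial1.
rewrite le_eqVlt; apply/orP; left; apply/eqP; congr (_ * _); apply: eq_bigr => i _.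
by rewrite (bernstein_real_monomial (K0 := n.*2.+1))// size_nseq.
Qed.

Theorem bernstein_real_expansion n f : smooth_on setT f -> (0 < n)%N ->
  decay P n (fun N x => bernstein_real N x f - \sum_(nu < n) N%:R ^- nu * expansion_term nu f x).
Proof.
move=> sf n0.
have cf : continuous f by move=> x; exact: smooth_on_continuous sf I.
(* The coefficient of [N ^- nu] in the expectation of the Taylor polynomial. For [nu < n] it is
   already [expansion_term nu]; the terms with [n <= nu < n.*2] go into the error. *)
pose T nu x := \sum_(k < n.*2) k`!%:R^-1 *
  \sum_(s <- words m k) coefficient nu s x * partials s f x.
have bT nu : bounded_by_const P (T nu).
  apply: bounded_by_const_sum => k; apply: bounded_by_constM.
    exact: bounded_by_const_cst.
  apply: bounded_by_const_sum => s.
  apply: (bounded_by_constM (g := fun x => coefficient nu s x) (h := partials s f)).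
    exact: (boundary_smooth_bounded (boundary_smooth_moment_coef nu s)).
  have [C _ HC] := partials_bounded (size s) sf.
  by exists C => x Px; exact: HC.
have oT : decay P n (fun N x => \sum_(n <= nu < n.*2) N%:R ^- nu * T nu x).
  rewrite (_ : (fun _ _ => _) = (fun N x => \sum_(nu <- index_iota n n.*2)
      (if (n <= nu)%N then N%:R ^- nu * T nu x else 0))); last first.
    apply/funext => N; apply/funext => x; apply: eq_big_seq => nu.
    by rewrite mem_index_iota => /andP[->].
  apply: decay_sum => nu; case: (boolP (n <= nu)%N) => nnu; last exact: decay0.
  exact: (decay_term nnu (bT nu)).
apply: decay_eq (decayD oT (taylor_remainder_decay sf n0)) => N x N0 Px.
rewrite bernstein_realB//; last exact: continuous_taylor_poly.
rewrite bernstein_real_taylor_poly//.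
have -> : \sum_(nu < n) N%:R ^- nu * expansion_term nu f x = \sum_(0 <= nu < n) N%:R ^- nu * T nu x.
  rewrite big_mkord; apply: eq_bigr => nu _.
  by rewrite (@expansion_term_widen nu n.*2)// ltn_double.
rewrite -/(T _ _) -(big_mkord xpredT (fun nu => N%:R ^- nu * T nu x)).
rewrite (@big_cat_nat _ _ _ n 0%N n.*2)//=; last by rewrite -addnn leq_addr.
ring.
Qed.

(** * Differentiating the expansion *)

Lemma expansion_term0 f x : expansion_term 0 f x = f x.
Proof.
rewrite /expansion_term big_ord1 fact0 invr1 mul1r /= big_seq1 moment_coef_nil.
by rewrite mul1r.
Qed.

Lemma smooth_coordM j f : smooth_on setT f -> smooth_on setT (fun z => z 0 j * f z).
Proof. exact: (smooth_onM openT (@smooth_on_coord R m setT j)). Qed.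

Lemma expansion_term_smooth nu f : smooth_on setT f -> smooth_on P° (expansion_term nu f).
Proof.
move=> sf; apply: (smooth_on_sum _ oP) => k _; apply: (smooth_onZ _ oP).
apply: (smooth_on_sum _ oP) => s _; apply: (smooth_onM oP).
  exact: (boundary_smooth_moment_coef nu s).2.
exact: smooth_on_subset (smooth_on_partials s sf).
Qed.

Definition remainder n f N x : R := bernstein_real N x f - \sum_(nu < n) N%:R ^- nu * expansion_term nu f x.

Definition expansion_term_grad nu f i x : R :=
  \sum_j K x i j * (expansion_term nu.+1 (fun z => z 0 j * f z) x - x 0 j * expansion_term nu.+1 f x).

Definition remainder_grad n f i N x : R :=
  N%:R * \sum_j K x i j * (remainder n.+1 (fun z => z 0 j * f z) N x - x 0 j * remainder n.+1 f N x).

(** As [L_0] is the identity, the terms of index 0 coming from [z_j f] and from [x_j] times [f]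
    cancel; the factor [N] then lowers every other index by one. *)
Lemma remainder_gradE n f i N x : (0 < N)%N ->
  remainder_grad n f i N x = bernstein_real_grad N x f i - \sum_(nu < n) N%:R ^- nu * expansion_term_grad nu f i x.
Proof.
move=> N0; have n0 : N%:R != 0 :> R by rewrite pnatr_eq0 -lt0n.
have splitS (F : nat -> R) : \sum_(nu < n.+1) N%:R ^- nu * F nu =
    F 0%N + N%:R^-1 * \sum_(nu < n) N%:R ^- nu * F nu.+1.
  rewrite big_ord_recl expr0 invr1 mul1r mulr_sumr; congr (_ + _).
  by apply: eq_bigr => nu _; rewrite exprS invfM mulrA.
have lin (k bz bf a c S1 S2 : R) : N%:R * (k * (bz - (a * c + N%:R^-1 * S1) -
    a * (bf - (c + N%:R^-1 * S2)))) = N%:R * (k * (bz - a * bf)) - k * (S1 - a * S2).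
  by field.
have -> : \sum_(nu < n) N%:R ^- nu * expansion_term_grad nu f i x =
    \sum_j K x i j * (\sum_(nu < n) N%:R ^- nu * expansion_term nu.+1 (fun z => z 0 j * f z) x -
      x 0 j * \sum_(nu < n) N%:R ^- nu * expansion_term nu.+1 f x).
  under eq_bigr do rewrite mulr_sumr.
  rewrite exchange_big /=; apply: eq_bigr => j _.
  rewrite mulr_sumr -sumrB mulr_sumr; apply: eq_bigr => nu _.
  by rewrite mulrCA mulrBr [x 0 j * (_ * _)]mulrCA -[in RHS]mulrBr mulrBr.
rewrite /remainder_grad /bernstein_real_grad !mulr_sumr -sumrB; apply: eq_bigr => j _.
rewrite /remainder (splitS (fun nu => expansion_term nu (fun z => z 0 j * f z) x)) (splitS (fun nu => expansion_term nu f x)).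
by rewrite !expansion_term0; exact: lin.
Qed.

Lemma smooth_bounded (D : set V) g : compact D -> D `<=` P° -> smooth_on P° g ->
  bounded_by_const D g.
Proof.
move=> cD DP sg; have cg : {within D, continuous g}.
  apply: continuous_in_subspaceT => x /set_mem Dx.
  exact: smooth_on_continuous sg (DP _ Dx).
by have [C _ HC] := compact_fun_bounded cD cg; exists C.
Qed.

Lemma remainder_decay n f : smooth_on setT f -> (0 < n)%N -> decay P n (remainder n f).
Proof. exact: (bernstein_real_expansion). Qed.

(** Remainders of order n + 1 pay for the factor [N], and compactness of [D] inside the interior
    bounds [K]. *)
Lemma remainder_grad_decay (D : set V) n f i : compact D -> D `<=` P° -> smooth_on setT f ->
  decay D n (remainder_grad n f i).
Proof.
move=> cD DP sf; have dE g : smooth_on setT g -> decay D n.+1 (remainder n.+1 g).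
  move=> sg; have [C HC] := remainder_decay (n := n.+1) sg isT.
  by exists C => N x N0 /DP /interior_sub Px; exact: HC.
apply: decay_scale; apply: decay_sum => j; apply: decayM.
  exact: smooth_bounded (defining_smooth bernB i j).
apply: (decay_eq (e := fun N x => remainder n.+1 (fun z => z 0 j * f z) N x +
    (- x 0 j) * remainder n.+1 f N x)).
  by move=> N x _ _; rewrite mulNr.
apply: decayD; first exact: dE (smooth_coordM j sf).
apply: decayM (dE _ sf); apply: smooth_bounded cD DP _.
by apply: (smooth_onN oP); exact: smooth_on_coord.
Qed.

(** The formulas for the lower indices are premises, so that the induction establishing them can
    call on this lemma. *)
Lemma is_derive_remainder n f i N y : (0 < N)%N -> P° y -> continuous f ->
  (forall nu, (nu < n)%N -> is_derive y (delta_mx 0 i) (expansion_term nu f) (expansion_term_grad nu f i y)) ->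
  is_derive y (delta_mx 0 i) (remainder n f N) (remainder_grad n f i N y).
Proof.
move=> N0 Py cf H; rewrite remainder_gradE//; apply: is_deriveB.
  exact: (bernstein_real_partial i N0 Py cf).
apply: is_derive_bigsum => nu; exact: is_deriveZ (H nu (ltn_ord nu)).
Qed.

Lemma expansion_term_grad_continuous nu f i x : P° x -> smooth_on setT f -> {for x, continuous (expansion_term_grad nu f i)}.
Proof.
move=> Px sf; apply: continuous_for_sum => j; apply: continuousM.
  exact: smooth_on_continuous (defining_smooth bernB i j) Px.
apply: continuousB.
  exact: smooth_on_continuous (expansion_term_smooth nu.+1 (smooth_coordM j sf)) Px.
apply: continuousM; first exact: coord_continuous.
exact: smooth_on_continuous (expansion_term_smooth nu.+1 sf) Px.
Qed.

Lemma normM_pow (N nu : nat) (e C : R) : (0 < N)%N -> `|e| <= C * N%:R ^- nu.+1 ->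
  `|N%:R ^+ nu * e| <= C * N%:R^-1.
Proof.
move=> N0 H; have n0 : 0 < N%:R :> R by rewrite ltr0n.
rewrite normrM (ger0_norm (exprn_ge0 _ (ltW n0))) -ler_pdivlMl ?exprn_gt0//.
by apply: le_trans H _; rewrite exprSr invfM mulrCA.
Qed.

(* [N ^ nu * remainder nu f N] converges to the operator of index [nu] together with its
   derivative, the latter by the formula for lower indices. *)
Lemma is_derive_expansion_term nu f i x : P° x -> smooth_on setT f ->
  is_derive x (delta_mx 0 i) (expansion_term nu f) (expansion_term_grad nu f i x).
Proof.
elim/ltn_ind: nu x => nu IH x Px sf.
have cf : continuous f by move=> y; exact: smooth_on_continuous sf I.
have [d d0 Hd] := near_line (delta_mx 0 i) (near_interior Px).
(* A closed segment of half the available length stays in the interior with its endpoints;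
   compactness is what [remainder_grad_decay] asks for. *)
pose D : set V := [set x + s *: delta_mx 0 i | s in `[- (d / 2), d / 2]].
have d2 : 0 < d / 2 by rewrite divr_gt0.
have DP : D `<=` P°.
  move=> _ [s /= s2 <-]; apply: Hd; move: s2; rewrite in_itv /= -ler_norml => s2.
  by rewrite (le_lt_trans s2)// ltr_pdivrMr// ltr_pMr// ltr1n.
have cl : continuous (fun s : R => x + s *: (delta_mx 0 i : V)).
  by move=> s; apply: cvgD; [exact: cvg_cst|exact: scalel_continuous].
have cD : compact D.
  exact: (continuous_compact (continuous_subspaceT cl) (@segment_compact _ _ _)).
have sD (s : R) : `|s| < d / 2 -> D (x + s *: delta_mx 0 i).
  by move=> sd; exists s => //=; rewrite in_itv /= -ler_norml ltW.
have [C HC] := remainder_decay (n := nu.+1) sf isT.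
have [C' HC'] := remainder_grad_decay nu.+1 i cD DP sf.
apply: (is_derive_limit (g := fun N y => N%:R ^+ nu * remainder nu f N y)
  (dg := fun N y => N%:R ^+ nu * remainder_grad nu f i N y) (b := expansion_term_grad nu f i) (C := Num.max C C') d2).
- move=> N s N0 /sD /DP Ps; apply: is_deriveZ; apply: is_derive_remainder => // mu munu.
  exact: IH.
- move=> N s N0 /sD /DP /interior_sub Ps.
  have n0 : N%:R != 0 :> R by rewrite pnatr_eq0 -lt0n.
  apply: (@le_trans _ _ (C * N%:R^-1)); last first.
    by rewrite ler_wpM2r ?invr_ge0 ?ler0n// le_max lexx.
  (* One more term is split off: [N ^+ nu] times the remainder of order [nu.+1] is [N ^+ nu] times
     that of order [nu], minus the operator of index [nu]. *)
  have := normM_pow N0 (HC N _ N0 Ps).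
  rewrite {1}/remainder big_ord_recr /= opprD addrA mulrBr mulrA mulfV ?expf_neq0// mul1r.
  exact.
- move=> N s N0 /sD Ds.
  have n0 : N%:R != 0 :> R by rewrite pnatr_eq0 -lt0n.
  apply: (@le_trans _ _ (C' * N%:R^-1)); last first.
    by rewrite ler_wpM2r ?invr_ge0 ?ler0n// le_max lexx orbT.
  have := normM_pow N0 (HC' N _ N0 Ds).
  rewrite (remainder_gradE nu.+1 _ _ _ N0) (remainder_gradE nu _ _ _ N0) big_ord_recr /= opprD addrA.
  by rewrite [X in `|X| <= _ -> _]mulrBr (mulVKf (expf_neq0 _ n0)).
- exact: expansion_term_grad_continuous.
Qed.

Lemma remainder_smooth n f N : (0 < N)%N -> smooth_on setT f -> smooth_on P° (remainder n f N).
Proof.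
move=> N0 sf; have cf : continuous f by move=> y; exact: smooth_on_continuous sf I.
apply: (smooth_onB oP); first exact: (bernstein_real_smooth N0 cf).
by apply: (smooth_on_sum _ oP) => nu _; apply: (smooth_onZ _ oP); exact: expansion_term_smooth.
Qed.

Lemma partial_remainder n f i N y : (0 < N)%N -> P° y -> smooth_on setT f ->
  partial i (remainder n f N) y = remainder_grad n f i N y.
Proof.
move=> N0 Py sf; have cf : continuous f by move=> x; exact: smooth_on_continuous sf I.
by have [_ <-] := is_derive_remainder (n := n) N0 Py cf (fun nu _ => is_derive_expansion_term nu i Py sf).
Qed.

Section locally_uniform.
Variable D : set V.
Hypotheses (cD : compact D) (DP : D `<=` P°).

Definition smooth_seq (e : nat -> V -> R) : Prop :=
  forall N, (0 < N)%N -> smooth_on P° (e N).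

Definition decay_upto (k n : nat) (e : nat -> V -> R) : Prop :=
  forall s, (size s <= k)%N -> decay D n (fun N => partials s (e N)).

Lemma decay_uptoD k n e e' : smooth_seq e -> smooth_seq e' ->
  decay_upto k n e -> decay_upto k n e' -> decay_upto k n (fun N x => e N x + e' N x).
Proof.
move=> se se' de de' s sk; apply: decay_eq (decayD (de s sk) (de' s sk)) => N x N0 /DP Px.
by rewrite (partialsD _ oP (se N N0) (se' N N0) Px).
Qed.

(** Leibniz's rule: [g] is independent of [N], and its derivatives are bounded on the compact
    [D]. *)
Lemma decay_uptoM k n g e : smooth_on P° g -> smooth_seq e ->
  decay_upto k n e -> decay_upto k n (fun N x => g x * e N x).
Proof.
elim: k g e => [|k IH] g e sg se de s.
  case: s => [_|//]; apply: decayM; first exact: smooth_bounded.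
  exact: (de [::]).
case/lastP: s => [_|s i].
  by apply: decayM; [exact: smooth_bounded|exact: (de [::])].
rewrite size_rcons ltnS => sk.
have spe : smooth_seq (fun N => partial i (e N)).
  by move=> N N0; exact: smooth_on_partial (se N N0).
have dpe : decay_upto k n (fun N => partial i (e N)).
  move=> t tk; have := de (rcons t i); rewrite size_rcons ltnS => /(_ tk).
  by apply: decay_eq => N x _ _; rewrite partials_rcons.
have de' : decay_upto k n e by move=> t tk; apply: de; exact: leqW.
have d1 := IH g _ sg spe dpe s sk.
have d2 := IH _ _ (smooth_on_partial i sg) se de' s sk.
apply: decay_eq (decayD d1 d2) => N x N0 /DP Px.
have sN := se N N0.
rewrite partials_rcons -(partialsD _ oP _ _ Px); last 2 first.
- exact: (smooth_onM oP sg (spe N N0)).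
- exact: (smooth_onM oP (smooth_on_partial i sg) sN).
apply: (eq_partials oP) Px => y Py.
by rewrite (partialM i sg sN Py) [partial i g y * _]mulrC.
Qed.

Lemma decay_upto_sum k n (I : Type) (r : seq I) (e : I -> nat -> V -> R) :
  (forall a, smooth_seq (e a)) -> (forall a, decay_upto k n (e a)) ->
  decay_upto k n (fun N x => \sum_(a <- r) e a N x).
Proof.
move=> se de s sk; apply: decay_eq (decay_sum r (fun a => de a s sk)) => N x N0 /DP Px.
by rewrite (partials_sum r s oP (fun a => se a N N0) Px).
Qed.

(** The induction on [k] is general in [n] and [f], because a step raises [n] and multiplies [f] by
    a coordinate. *)
Lemma remainder_decay_upto k n f : smooth_on setT f -> (0 < n)%N -> decay_upto k n (remainder n f).
Proof.
have dE0 g p : smooth_on setT g -> (0 < p)%N -> decay D p (remainder p g).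
  move=> sg p0; have [C HC] := remainder_decay sg p0.
  by exists C => N x N0 /DP /interior_sub Px; exact: HC.
elim: k n f => [|k IH] n f sf n0 s.
  by case: s => [_|//]; exact: dE0.
case/lastP: s => [_|s i]; first exact: dE0.
rewrite size_rcons ltnS => sk.
pose T j N x := K x i j *
  (remainder n.+1 (fun z => z 0 j * f z) N x + (- x 0 j) * remainder n.+1 f N x).
have sE g : smooth_on setT g -> smooth_seq (remainder n.+1 g).
  by move=> sg N N0; exact: remainder_smooth.
have sc j : smooth_on P° (fun x : V => - x 0 j).
  by apply: (smooth_onN oP); exact: smooth_on_coord.
have sxE j : smooth_seq (fun N x => (- x 0 j) * remainder n.+1 f N x).
  by move=> N N0; exact: (smooth_onM oP (sc j) (sE _ sf N N0)).
have sin j : smooth_seq (fun N x =>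
    remainder n.+1 (fun z => z 0 j * f z) N x + (- x 0 j) * remainder n.+1 f N x).
  by move=> N N0; exact: (smooth_onD oP (sE _ (smooth_coordM j sf) N N0) (sxE j N N0)).
have sT j : smooth_seq (T j).
  by move=> N N0; exact: (smooth_onM oP (defining_smooth bernB i j) (sin j N N0)).
have dT j : decay_upto k n.+1 (T j).
  apply: (decay_uptoM (defining_smooth bernB i j) (sin j)).
  apply: (decay_uptoD (sE _ (smooth_coordM j sf)) (sxE j)).
    exact: IH (smooth_coordM j sf) _.
  exact: (decay_uptoM (sc j) (sE _ sf) (IH _ _ sf _)).
have sS : smooth_seq (fun N x => \sum_j T j N x).
  by move=> N N0; apply: (smooth_on_sum _ oP) => j _; exact: sT.
apply: decay_eq (decay_scale (decay_upto_sum _ sT dT sk)) => N x N0 /DP Px.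
rewrite partials_rcons; apply: etrans (esym (partialsZ N%:R s oP (sS N N0) Px)) _.
apply: (eq_partials oP _ s Px) => y Py; rewrite (partial_remainder n i N0 Py sf).
by congr (_ * _); apply: eq_bigr => j _; rewrite /T mulNr.
Qed.

End locally_uniform.

(** * Differential operators *)

(** All words with the letter counts [al] stand for one derivative, so their coefficients are
    gathered. *)
Definition operator_coef nu (al : multi_index m (2 * nu)) x : R :=
  \sum_(k < nu.*2.+1) k`!%:R^-1 *
    \sum_(s <- words m k | has_counts al s) coefficient nu s x.

Lemma boundary_smooth_operator_coef nu al : boundary_smooth (@operator_coef nu al).
Proof.
apply: boundary_smooth_sum => k _; apply: boundary_smoothM; first exact: boundary_smooth_cst.
by apply: boundary_smooth_sum => s _; exact: (boundary_smooth_moment_coef).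
Qed.

Lemma operator_coef_continuous nu (al : multi_index m (2 * nu)) :
  ccontinuous_on P (fun x => Complex (operator_coef al x) 0).
Proof.
split; first exact: (boundary_smooth_operator_coef al).1.
by apply: continuous_subspaceT => x; exact: cst_continuous.
Qed.

Lemma operator_coef_smooth nu (al : multi_index m (2 * nu)) :
  csmooth_on P° (fun x => Complex (operator_coef al x) 0).
Proof. by split; [exact: (boundary_smooth_operator_coef al).2|exact: smooth_on_cst]. Qed.

Definition operator nu : diff_operator P (2 * nu) :=
  DiffOperator (@operator_coef_continuous nu) (@operator_coef_smooth nu).

(** Each word goes to the unique multi-index counting its letters, and symmetry of mixed derivatives
    identifies its derivative with that of the sorted word. *)
Lemma sum_operator_coef nu g x : smooth_on setT g ->
  \sum_(al : multi_index m (2 * nu)) operator_coef al x *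
    partials (sorted_word (fun i => val al i)) g x = expansion_term nu g x.
Proof.
move=> sg; rewrite /operator_coef /expansion_term.
under eq_bigr do rewrite mulr_suml.
rewrite exchange_big /=; apply: eq_bigr => k _.
under eq_bigr do rewrite -mulrA mulr_suml.
rewrite -mulr_sumr; congr (_ * _).
rewrite (exchange_big_dep xpredT)//=; apply: eq_big_seq => s; rewrite mem_words => /eqP sk.
apply: sum_has_counts => [|al /forallP H].
  by rewrite sk mul2n -ltnS.
by congr (_ * _); apply/esym/partials_perm/perm_sorted_word => // i; apply/eqP/H.
Qed.

Lemma operatorE nu (f : V -> R[i]) : csmooth_on setT f ->
  diff_apply (operator nu) f =
  fun x => Complex (expansion_term nu (@complex.Re R \o f) x) (expansion_term nu (@complex.Im R \o f) x).
Proof.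
move=> [sr si]; apply/funext => x.
rewrite -(sum_operator_coef nu x sr) -(sum_operator_coef nu x si) -Complex_sum.
apply: eq_bigr => al _; rewrite cderivE -real_complexM.
by congr (_ * _).
Qed.

(** * The covariance matrix and the operator of index 1 *)

Lemma covarianceE x i j : covariance_matrix P B x i j = E x (fun z => (z - x) 0 i * (z - x) 0 j).
Proof. by rewrite mxE conv_integral1. Qed.

Lemma covariance_sym x : (covariance_matrix P B x)^T = covariance_matrix P B x.
Proof.
apply/matrixP => i j; rewrite mxE !covarianceE.
by apply: eq_Lam => z _; rewrite mulrC.
Qed.

Lemma covariance_moment x i j : covariance_matrix P B x i j = moment x [:: i; j].
Proof.
rewrite covarianceE; apply: eq_Lam => z _.
by rewrite /monomial !big_cons big_nil mulr1.
Qed.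

(** The gradient identity for the function [z_k]: its expectation is [x_k] by the barycentre
    condition, so one side is an entry of the identity matrix and the other an entry of [K] times
    the covariance. *)
Lemma mul_defining_covariance x : P° x -> K x *m covariance_matrix P B x = 1%:M.
Proof.
move=> Px; have Px' := interior_sub Px; apply/matrixP => i k; rewrite !mxE.
have ck j : continuous (fun z : V => z 0 j) by exact: coord_continuous.
have d1 : is_derive x (delta_mx 0 i) (fun x => E x (fun z => z 0 k)) ((i == k)%:R).
  apply: (eq_is_derive_on (g := fun x : V => x 0 k) oP Px).
    by move=> y /interior_sub Py; rewrite (expectation_coord).
  apply: (is_derive_eq (is_derive_coord k x (delta_mx 0 i))).
  by rewrite mxE eqxx /= eq_sym.
have d2 := expectation_partial i (ck k) Px.
have <- : \sum_j K x i j * (E x (fun z => z 0 j * z 0 k) - x 0 j * E x (fun z => z 0 k)) =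
    (i == k)%:R.
  by have [_ <-] := d1; have [_ <-] := d2.
apply: eq_bigr => j _; congr (_ * _); rewrite covarianceE.
have cjk : continuous (fun z : V => z 0 j * z 0 k) by exact: continuousM_coord.
have ckj : continuous (fun z : V => x 0 k * z 0 j) by exact: continuous_scale.
have cjk' : continuous (fun z : V => x 0 j * z 0 k) by exact: continuous_scale.
have cc : continuous ((fun=> x 0 j * x 0 k) : V -> R) by move=> z; exact: cst_continuous.
transitivity (E x (fun z => (z 0 j * z 0 k - x 0 k * z 0 j) - (x 0 j * z 0 k - x 0 j * x 0 k))).
  by apply: eq_Lam => z _; rewrite !mxE; ring.
rewrite conv_integralB//; [|exact: continuous_sub|exact: continuous_sub].
rewrite !conv_integralB// (conv_integral_cst cptP convP P0 1 (bernstein_supp bernB Px')) !conv_integralZ//.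
by rewrite !(expectation_coord)//; ring.
Qed.

(** Words of length 0 and 1 have coefficient zero at index 1; those of length 2 carry the weight
    [1 / 2!]. *)
Lemma expansion_term1 f x : expansion_term 1 f x =
  2^-1 * \sum_i \sum_j covariance_matrix P B x i j * partial j (partial i f) x.
Proof.
pose G k := k`!%:R^-1 *
  \sum_(s <- words m k) moment_coef (moment x) 1 s * partials s f x.
have -> : expansion_term 1 f x = G 0%N + G 1%N + G 2%N.
  by rewrite /expansion_term !big_ord_recr big_ord0 /= add0r.
have -> : G 0%N = 0 by rewrite /G big_seq1 moment_coef_nil mul0r mulr0.
have -> : G 1%N = 0.
  by rewrite /G big_words big1 ?mulr0// => i _; rewrite big_seq1 moment_coef1 mul0r.
rewrite !add0r /G; congr (_ * _); rewrite big_words.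
under eq_bigr do rewrite big_words.
(* Exchanging the two letters gives the index order of the trace of a product, at the cost of the
   symmetry of the covariance. *)
rewrite exchange_big /=; apply: eq_bigr => i _; apply: eq_bigr => j _.
rewrite big_seq1 moment_coef2 -covariance_moment; congr (_ * _).
by rewrite -[in RHS]covariance_sym [RHS]mxE.
Qed.

Lemma bernstein_approxE N (f : V -> R[i]) x : (0 < N)%N -> csmooth_on setT f ->
  bernstein_approx P B N f x =
  Complex (bernstein_real N x (@complex.Re R \o f)) (bernstein_real N x (@complex.Im R \o f)).
Proof.
move=> N0 [sr si]; rewrite /bernstein_approx /cintegral /by_parts.
by rewrite !bernstein_powerE// => y; [exact: smooth_on_continuous si I|exact: smooth_on_continuous sr I].
Qed.

Lemma approx_remainderE n N (f : V -> R[i]) x : (0 < N)%N -> csmooth_on setT f ->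
  bernstein_approx P B N f x -
    \sum_(nu < n) N%:R ^- nu * diff_apply (operator nu) f x =
  Complex (remainder n (@complex.Re R \o f) N x) (remainder n (@complex.Im R \o f) N x).
Proof.
move=> N0 sf; rewrite bernstein_approxE//.
rewrite (eq_bigr (fun nu : 'I_n => Complex (N%:R ^- nu * expansion_term nu (@complex.Re R \o f) x)
  (N%:R ^- nu * expansion_term nu (@complex.Im R \o f) x))).
  by rewrite Complex_sum ComplexB.
by move=> nu _; rewrite operatorE// natVX_complexM.
Qed.

Lemma uniform_bigO_parts (D : set V) n (a b : nat -> V -> R) (e : nat -> V -> R[i]) :
  (forall N x, (0 < N)%N -> D x -> e N x = Complex (a N x) (b N x)) ->
  decay D n a -> decay D n b -> uniform_bigO D n e.
Proof.
move=> eE [C HC] [C' HC']; exists (C + C'); near=> N => x Dx.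
have N0 : (0 < N)%N by near: N; exact: nbhs_infty_gt.
rewrite eE// (le_trans (normc_le _ _))// mulrDl.
by rewrite lerD ?HC ?HC'.
Unshelve. all: by end_near. Qed.

(** Derivatives pass through the finite sum because each of its terms is smooth on the interior. *)
Lemma cderiv_remainderE beta n N (f : V -> R[i]) x : (0 < N)%N -> P° x -> csmooth_on setT f ->
  cderiv beta (bernstein_approx P B N f) x -
    \sum_(nu < n) N%:R ^- nu * cderiv beta (diff_apply (operator nu) f) x =
  Complex (partials (sorted_word beta) (remainder n (@complex.Re R \o f) N) x)
          (partials (sorted_word beta) (remainder n (@complex.Im R \o f) N) x).
Proof.
move=> N0 Px sf; rewrite cderivE.
rewrite (eq_bigr (fun nu : 'I_n => Complex
  (N%:R ^- nu * partials (sorted_word beta) (expansion_term nu (@complex.Re R \o f)) x)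
  (N%:R ^- nu * partials (sorted_word beta) (expansion_term nu (@complex.Im R \o f)) x))); last first.
  by move=> nu _; rewrite cderivE natVX_complexM operatorE.
rewrite Complex_sum ComplexB.
have H g : smooth_on setT g -> partials (sorted_word beta) (remainder n g N) x =
   partials (sorted_word beta) (fun y => bernstein_real N y g) x -
   \sum_(nu < n) N%:R ^- nu * partials (sorted_word beta) (expansion_term nu g) x.
  move=> sg; have cg : continuous g by move=> y; exact: smooth_on_continuous sg I.
  have sL nu : smooth_on P° (expansion_term nu g) by exact: (expansion_term_smooth nu sg).
  have sb := bernstein_real_smooth N0 cg.
  have sLN (nu : 'I_n) : smooth_on P° (fun y => N%:R ^- nu * expansion_term nu g y).
    exact: (smooth_onZ _ oP (sL nu)).
  rewrite (partialsB _ oP sb (smooth_on_sum _ oP (fun nu _ => sLN nu)) Px).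
  rewrite (partials_sum _ _ oP sLN Px); congr (_ - _).
  by apply: eq_bigr => nu _; rewrite (partialsZ _ _ oP (sL nu) Px).
have [sr si] := sf; rewrite (H _ sr) (H _ si).
have -> : @complex.Re R \o bernstein_approx P B N f = fun y => bernstein_real N y (@complex.Re R \o f).
  by apply/funext => y; exact: (congr1 (@complex.Re R) (bernstein_approxE y N0 sf)).
suff -> : @complex.Im R \o bernstein_approx P B N f = fun y => bernstein_real N y (@complex.Im R \o f) by [].
by apply/funext => y; exact: (congr1 (@complex.Im R) (bernstein_approxE y N0 sf)).
Qed.

End bernstein_calculus.

Theorem theorem2p9 (R : realType) (m : nat) (P : set 'rV[R]_m)
    (B : 'rV[R]_m -> probability (Borel R m) R) (K : 'rV[R]_m -> 'M[R]_m)
    (polyP : polytope P) (intP : P° !=set0) (bernB : bernstein_measure P B K) :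
  exists L : forall nu : nat, diff_operator P (2 * nu),
  [/\ forall f : 'rV[R]_m -> R[i], csmooth_on setT f ->
        forall n : nat, (0 < n)%N ->
        uniform_bigO P n (fun N x => bernstein_approx P B N f x -
          \sum_(nu < n) N%:R ^- nu * diff_apply (L nu) f x),
      forall f : 'rV[R]_m -> R[i], csmooth_on setT f ->
        forall x, P x -> diff_apply (L 0%N) f x = f x /\
          diff_apply (L 1%N) f x = 2^-1 *
            \tr (map_mx (real_complex R) (covariance_matrix P B x) *m
                 hessian f x),
      forall x, P x -> (covariance_matrix P B x)^T = covariance_matrix P B x,
      forall x, P° x ->
        K x \in unitmx /\ covariance_matrix P B x = invmx (K x)
    & forall f : 'rV[R]_m -> R[i], csmooth_on setT f ->
        (forall N : nat, (0 < N)%N ->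
           csmooth_on P° (bernstein_approx P B N f)) /\
        (forall (beta : 'I_m -> nat) (n : nat) (C : set 'rV[R]_m),
           (0 < n)%N -> compact C -> C `<=` P° ->
           uniform_bigO C n (fun N x =>
             cderiv beta (bernstein_approx P B N f) x -
             \sum_(nu < n) N%:R ^- nu *
               cderiv beta (diff_apply (L nu) f) x))].
Proof.
exists (operator polyP bernB); split.
- move=> f sf n n0; have [sr si] := sf.
  apply: (uniform_bigO_parts (a := remainder P B n (@complex.Re R \o f))
    (b := remainder P B n (@complex.Im R \o f))).
  + by move=> N x N0 _; exact: approx_remainderE.
  + exact: (remainder_decay polyP intP bernB sr n0).
  + exact: (remainder_decay polyP intP bernB si n0).
- move=> f sf x Px; rewrite !operatorE// !expansion_term0 -Complex_eta; split=> //.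
  rewrite !expansion_term1 -[2^-1 in RHS](_ : real_complex R 2^-1 = _); last first.
    by rewrite fmorphV rmorph_nat.
  rewrite -real_complexM; congr (_ * _).
  rewrite -Complex_sum; apply: eq_bigr => i _.
  rewrite -Complex_sum mxE; apply: eq_bigr => j _.
  rewrite -real_complexM; congr (_ * _); first by rewrite [RHS]mxE.
  by rewrite [RHS]mxE.
- by move=> x _; exact: covariance_sym.
- move=> x Px; have KA := mul_defining_covariance polyP intP bernB Px.
  (* For square matrices a one-sided inverse is the inverse. *)
  have [Ku _] := mulmx1_unit KA; split=> //.
  by rewrite -[LHS](mulKmx Ku) KA mulmx1.
- move=> f sf; have [sr si] := sf; split=> [N N0|beta n C n0 cC CP].
    have cr : continuous (@complex.Re R \o f).
      by move=> y; exact: smooth_on_continuous sr I.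
    have ci : continuous (@complex.Im R \o f).
      by move=> y; exact: smooth_on_continuous si I.
    split.
      rewrite (_ : _ \o _ = fun y => bernstein_real P B N y (@complex.Re R \o f)).
        exact: (bernstein_real_smooth polyP intP bernB N0 cr).
      by apply/funext => y; exact: (congr1 (@complex.Re R) (bernstein_approxE B polyP y N0 sf)).
    rewrite (_ : _ \o _ = fun y => bernstein_real P B N y (@complex.Im R \o f)).
      exact: (bernstein_real_smooth polyP intP bernB N0 ci).
    by apply/funext => y; exact: (congr1 (@complex.Im R) (bernstein_approxE B polyP y N0 sf)).
  apply: (uniform_bigO_parts
    (a := fun N => partials (sorted_word beta) (remainder P B n (@complex.Re R \o f) N))
    (b := fun N => partials (sorted_word beta) (remainder P B n (@complex.Im R \o f) N))).
  + by move=> N x N0 /CP Px; exact: cderiv_remainderE.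
  + exact: (remainder_decay_upto polyP intP bernB cC CP sr n0 (leqnn _)).
  + exact: (remainder_decay_upto polyP intP bernB cC CP si n0 (leqnn _)).
Qed.
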